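(* Let $X$ and $Y$ be completely regular spaces. Suppose that measures $\mu_n\in\mathcal{P}_r(X)$ converge weakly to a measure $\mu\in\mathcal{P}_r(X)$, measures $\nu_n\in\mathcal{P}_r(Y)$ converge weakly to a measure $\nu\in\mathcal{P}_r(Y)$, both sequences are uniformly tight, and continuous functions $h_n\colon X\times Y\to[0,+\infty)$ converge to a function $h\colon X\times Y\to[0,+\infty)$ uniformly on compact sets. Suppose also that there are nonnegative Borel functions $a_n\in L^1(\mu_n)$ and $b_n\in L^1(\nu_n)$ such that $$h_n(x,y)\le a_n(x)+b_n(y),\qquad \lim_{R\to+\infty}\sup_n\Bigl(\int_{\{a_n\ge R\}}a_n\,d\mu_n+\int_{\{b_n\ge R\}}b_n\,d\nu_n\Bigr)=0.$$ If the optimal plans $\sigma_n$ and $\sigma$ for the triples $(\mu_n,\nu_n,h_n)$ and $(\mu,\nu,h)$ are unique, then the measures $\sigma_n$ converge weakly to $\sigma$.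
   Context: Completely regular spaces are Hausdorff. $\mathcal{P}_r(Z)$ is the set of Radon probability measures on $Z$: Borel probability measures $\mu$ such that for every Borel set $B$ and $\varepsilon>0$ there is a compact set $K\subset B$ with $\mu(B\setminus K)<\varepsilon$. Weak convergence means convergence of integrals of all bounded continuous functions. A set $\mathcal{M}$ of such measures is uniformly tight if for every $\varepsilon>0$ there is a compact set $K\subset Z$ with $\mu(Z\setminus K)<\varepsilon$ for all $\mu\in\mathcal{M}$. $\Pi(\mu,\nu)$ is the set of Radon probability measures $\sigma$ on $X\times Y$ with $\sigma(A\times Y)=\mu(A)$ and $\sigma(X\times B)=\nu(B)$ for all Borel $A\subset X$, $B\subset Y$. For a nonnegative Borel function $h$ on $X\times Y$, $K_h(\mu,\nu)=\inf_{\sigma\in\Pi(\mu,\nu)}\int h\,d\sigma$. An optimal plan for $(\mu,\nu,h)$ is a measure $\sigma\in\Pi(\mu,\nu)$ with $\int h\,d\sigma=K_h(\mu,\nu)$. *)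

(* Defs.v *)
From HB Require Import structures.
From mathcomp Require Import all_boot all_order all_algebra.
From mathcomp Require Import all_classical all_reals all_analysis.

Set Implicit Arguments.
Unset Strict Implicit.
Unset Printing Implicit Defensive.

Import Order.TTheory GRing.Theory Num.Theory.
Import numFieldNormedType.Exports.

Local Open Scope classical_set_scope.
Local Open Scope ring_scope.

HB.instance Definition _ (X Y : ptopologicalType) := Pointed.on (X * Y)%type.

(* A measurableType is pointed, hence the ptopologicalType carriers; this costs
   nothing here, since a space carrying a probability measure is nonempty.
   On a product, [borel (X * Y)%type] is generated by the open sets of the
   product topology; it may be strictly larger than the product of the two
   Borel sigma-algebras. *)
Notation borel T := (g_sigma_algebraType (@open T)).

(* Naming this type lets unification recover the topology of [T], in particular
   when [T] is a product. *)
Definition borel_probability (R : realType) (T : ptopologicalType) : Type :=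
  probability (borel T) R.

(* [completely_regular_space] is the existence of continuous [0, 1]-valued
   functions separating points from closed sets (see [uniform_separatorP]);
   it does not include the Hausdorff property. *)
Definition completely_regular_hausdorff (T : ptopologicalType) : Prop :=
  completely_regular_space T /\ hausdorff_space T.

(* In a Hausdorff space the compact set [K] below is closed, hence Borel. *)
Definition radon (R : realType) (T : ptopologicalType)
    (mu : borel_probability R T) : Prop :=
  forall (B : set (borel T)) (e : R), measurable B -> 0 < e ->
    exists K : set T, [/\ compact K, K `<=` B & (mu (B `\` K) < e%:E)%E].

Definition weakly_converges (R : realType) (T : ptopologicalType)
    (mu_ : nat -> borel_probability R T) (mu : borel_probability R T)
    : Prop :=
  forall f : T -> R, continuous f -> bounded_fun f ->
    ((\int[mu_ n]_x (f x)%:E)%E @[n --> \oo] --> (\int[mu]_x (f x)%:E)%E).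

Definition uniformly_tight (R : realType) (T : ptopologicalType)
    (M : set (borel_probability R T)) : Prop :=
  forall e : R, 0 < e ->
    exists K : set T, compact K /\ forall mu, M mu -> (mu (~` K) < e%:E)%E.

Section Kantorovich.
Context (R : realType) (X Y : ptopologicalType).
Implicit Types (mu : borel_probability R X) (nu : borel_probability R Y).
Implicit Types (h : X * Y -> R) (sigma : borel_probability R (X * Y)%type).

Definition plans mu nu :=
  [set sigma : borel_probability R (X * Y)%type | [/\ radon sigma,
    forall A : set X, measurable (A : set (borel X)) ->
      sigma (A `*` [set: Y]) = mu A &
    forall B : set Y, measurable (B : set (borel Y)) ->
      sigma ([set: X] `*` B) = nu B]].

Definition kantorovich_cost mu nu h : \bar R :=
  ereal_inf [set (\int[sigma]_z (h z)%:E)%E | sigma in plans mu nu].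

Definition optimal_plan mu nu h sigma : Prop :=
  plans mu nu sigma /\
  (\int[sigma]_z (h z)%:E)%E = kantorovich_cost mu nu h.

(* Plans are compared on Borel sets only: the underlying set functions are
   unconstrained on non-Borel sets, so Leibniz equality would be too strong. *)
Definition unique_optimal_plan mu nu h sigma : Prop :=
  optimal_plan mu nu h sigma /\
  forall sigma', optimal_plan mu nu h sigma' ->
    forall C : set (borel (X * Y)%type), measurable C -> sigma' C = sigma C.

End Kantorovich.

(* Main.v *)
(* Along an ultrafilter the plans [sigma_ n] converge weakly to a Radon plan
   [sigma'] (Prokhorov), so by uniqueness it suffices that [sigma'] be optimal.
   The tail condition and tightness reduce all costs, up to [e], to integrals of
   one bounded continuous function [F], namely a truncation of some [h_ N]. Weak
   convergence then bounds the cost of [sigma'] by that of [sigma_ n], hence by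
   that of any plan of [mu_ n] and [nu_ n]; such a competitor with
   [mean pi F <= mean sigma F + e] is obtained by averaging [sigma] over small
   boxes given by bump functions and transporting the resulting matrix to
   [mu_ n] and [nu_ n].

   Measures on the Borel sets of [X * Y] (ultrafilter limits, products, measures
   with a density) are all produced from positive linear functionals on bounded
   continuous functions that are tight, by a Riesz theorem. *)

Require Import Defs.
From HB Require Import structures.
From mathcomp Require Import all_boot all_order all_algebra finmap.
From mathcomp Require Import all_classical all_reals all_analysis.
From mathcomp Require Import measurable_realfun ring lra.

Set Implicit Arguments.
Unset Strict Implicit.
Unset Printing Implicit Defensive.

Import Order.TTheory GRing.Theory Num.Theory.
Import numFieldNormedType.Exports.

Local Open Scope classical_set_scope.
Local Open Scope ring_scope.

(** * Bounded continuous functions and bumps *)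

(** The limit cost [h] is continuous on each compact set, but nothing makes it continuous or Borel
    on all of [X * Y]. It therefore cannot serve as a test function for weak convergence: the test
    function is built from a single [h_ N] close to [h] on a large compact rectangle, and the
    integral of [h] is handled as a supremum over simple functions below it. The other obstacle is
    that [sigma] is not a plan between [mu_ n] and [nu_ n], so optimality of [sigma_ n] says nothing
    about it directly. Weak convergence controls only finitely many integrals at a time; this is why
    [sigma] is first reduced to a finite matrix of box masses. Such a matrix transported to [mu_ n]
    and [nu_ n] has marginals that are only approximately right, so it is shrunk slightly and the
    missing mass is added back; on that small mass the boundedness of [F] keeps the cost under
    control. *)

Definition bcont (R : realType) (Z : topologicalType) (f : Z -> R) : Prop :=
  continuous f /\ exists M, forall z, `|f z| <= M.

Section bcont_algebra.
Context {R : realType} {Z : topologicalType}.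
Implicit Types f g : Z -> R.

Lemma bcont_bounded_fun f : bcont f <-> continuous f /\ bounded_fun f.
Proof.
split=> -[cf bf]; split=> //.
  case: bf => M Mf; exists M; split; first exact: num_real.
  by move=> N MN z _; exact: le_trans (Mf z) (ltW MN).
by case: bf => M [_ Mf]; exists (M + 1) => z; apply: Mf => //; rewrite ltrDl.
Qed.

Lemma bcont_cst (c : R) : bcont (fun _ : Z => c).
Proof. by split; [exact: cst_continuous|exists `|c|]. Qed.

Lemma bcontD f g : bcont f -> bcont g ->
  bcont (fun z => f z + g z).
Proof.
move=> [cf [M Mf]] [cg [N Ng]]; split.
  by move=> z; apply: cvgD; [exact: cf|exact: cg].
by exists (M + N) => z; rewrite (le_trans (ler_normD _ _))// lerD.
Qed.

Lemma bcontM f g : bcont f -> bcont g ->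
  bcont (fun z => f z * g z).
Proof.
move=> [cf [M Mf]] [cg [N Ng]]; split.
  by move=> z; apply: cvgM; [exact: cf|exact: cg].
by exists (M * N) => z; rewrite normrM ler_pM.
Qed.

Lemma bcontZ (c : R) f : bcont f -> bcont (fun z => c * f z).
Proof. by move=> cf; apply: bcontM => //; exact: bcont_cst. Qed.

Lemma bcontN f : bcont f -> bcont (fun z => - f z).
Proof.
move=> /(bcontZ (-1)); congr bcont; apply/funext => z; exact: mulN1r.
Qed.

Lemma bcontB f g : bcont f -> bcont g ->
  bcont (fun z => f z - g z).
Proof. by move=> cf cg; apply: bcontD => //; exact: bcontN. Qed.

Lemma bcont_max f g : bcont f -> bcont g ->
  bcont (fun z => Num.max (f z) (g z)).
Proof.
move=> [cf [M Mf]] [cg [N Ng]]; split.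
  by move=> z; apply: continuous_max; [exact: cf|exact: cg].
exists (Num.max M N) => z.
by rewrite le_max; case: (leP (f z) (g z)); rewrite ?Mf ?Ng ?orbT.
Qed.

Lemma bcont_sum (I : Type) (s : seq I) (P : pred I) (F : I -> Z -> R) :
  (forall i, bcont (F i)) ->
  bcont (fun z => \sum_(i <- s | P i) F i z).
Proof.
move=> cF; elim: s => [|i s IH].
  by under eq_fun do rewrite big_nil; exact: bcont_cst.
under eq_fun do rewrite big_cons; case: (P i) => //; exact: bcontD.
Qed.

Lemma bcont_min_cst (M : R) f : continuous f -> (forall z, 0 <= f z) ->
  bcont (fun z => Num.min (f z) M).
Proof.
move=> cf f0; split.
  by move=> z; apply: continuous_min; [exact: cf|exact: cst_continuous].
exists `|M| => z; rewrite ler_norml; apply/andP; split.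
  rewrite le_min (le_trans _ (f0 z)) ?oppr_le0 ?normr_ge0//=.
  by rewrite lerNl ler_normr lexx orbT.
by rewrite ge_min ler_norm orbT.
Qed.

End bcont_algebra.

Lemma bcont_comp (R : realType) (Z W : topologicalType) (p : W -> Z) (f : Z -> R) :
  continuous p -> bcont f -> bcont (f \o p).
Proof.
move=> cp [cf [M Mf]]; split; last by exists M => w; exact: Mf.
by move=> w; apply: continuous_comp; [exact: cp|exact: cf].
Qed.

(** Complete regularity in the form that passes to products: the product of two bumps is a bump for
    a box. *)
Definition has_bumps (R : realType) (Z : topologicalType) : Prop :=
  forall (z : Z) (N : set Z), nbhs z N -> exists f : Z -> R,
    [/\ bcont f, forall w, 0 <= f w <= 1, f z = 1
      & forall w, ~ N w -> f w = 0].

Lemma completely_regular_has_bumps (R : realType) (Z : topologicalType) :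
  completely_regular_space Z -> has_bumps R Z.
Proof.
move=> crZ z N; rewrite nbhsE => -[U [oU Uz] UN].
have /(@uniform_separatorP _ R)[f [cf f01 fz f1]] :=
  crZ z (~` U) (open_closedC oU) (fun h => h Uz).
have {}f01 w : 0 <= f w <= 1.
  by have : (range f) (f w) by []; move=> /f01; rewrite /= in_itv.
exists (fun w => 1 - f w); split.
- apply: bcontB; [exact: bcont_cst|split=> //; exists 1 => w].
  by case/andP: (f01 w) => ? ?; rewrite ger0_norm.
- by move=> w; have := f01 w; lra.
- by rewrite (fz (f z)) ?subr0//; exists z.
- move=> w Nw; rewrite (f1 (f w)) ?subrr//; exists w => //.
  by move=> Uw; apply: Nw; exact: UN.
Qed.

Lemma has_bumps_prod (R : realType) (X Y : topologicalType) :
  has_bumps R X -> has_bumps R Y -> has_bumps R (X * Y)%type.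
Proof.
move=> bX bY [x y] N [[A B] /= [Ax By] ABN].
have [f [cf f01 fx fA]] := bX _ _ Ax.
have [g [cg g01 gy gB]] := bY _ _ By.
exists (fun w => f w.1 * g w.2); split.
- apply: bcontM.
    by apply: (@bcont_comp R X _ fst) => // -[? ?]; exact: cvg_fst.
  by apply: (@bcont_comp R Y _ snd) => // -[? ?]; exact: cvg_snd.
- move=> w; case/andP: (f01 w.1) => ? ?; case/andP: (g01 w.2) => ? ?.
  by rewrite mulr_ge0// mulr_ile1.
- by rewrite /= fx gy mulr1.
- move=> w Nw; have [Aw|/fA ->] := pselect (A w.1); last by rewrite mul0r.
  rewrite gB ?mulr0// => Bw; apply: Nw; exact: ABN.
Qed.

(** A partition of unity on a compact set only, since the whole space need not admit one: finitely
    many sets where a bump exceeds 1/2 cover [K], and normalizing these bumps gives total 1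
    there. *)
Lemma subordinate_bumps (R : realType) (Z : ptopologicalType) (K : set Z)
    (N : Z -> set Z) :
  has_bumps R Z -> compact K -> (forall z, K z -> nbhs z (N z)) ->
  exists (s : seq Z) (phi : Z -> Z -> R),
    [/\ forall i, i \in s -> K i,
        forall i, bcont (phi i),
        forall i z, 0 <= phi i z,
        forall i z, ~ N i z -> phi i z = 0
      & (forall z, \sum_(i <- s) phi i z <= 1) /\
        (forall z, K z -> \sum_(i <- s) phi i z = 1)].
Proof.
move=> bZ cK KN.
have /choice[g gP] : forall i, exists f : Z -> R,
    [/\ bcont f, forall w, 0 <= f w <= 1, K i -> f i = 1
      & forall w, ~ N i w -> f w = 0].
  move=> i; have [/KN /bZ[f [? ? ? ?]]|nKi] := pselect (K i); first by exists f.
  exists (fun=> 0); split=> //; first exact: bcont_cst.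
  by move=> w; rewrite lexx ler01.
have cg i : continuous (g i) by have [[]] := gP i.
have g0 i z : 0 <= g i z by have [_ /(_ z)/andP[]] := gP i.
move: cK; rewrite compact_cover.
move=> /(_ _ K (fun i => [set z | 2^-1 < g i z])) [||D DK cov].
- by move=> i _; move/continuousP : (cg i) => /(_ _ (@open_gt _ 2^-1)).
- move=> z Kz; exists z => //=; have [_ _ -> // _] := gP z.
  by rewrite invf_lt1// ltr1n.
pose s : seq Z := finmap.enum_fset D.
pose S z := \sum_(i <- s) g i z.
have cS : bcont S by apply: bcont_sum => i; have [] := gP i.
have S0 z : 0 <= S z by apply: sumr_ge0 => i _; exact: g0.
(* Dividing by [S] itself would break continuity where [S] vanishes. On [K] some bump exceeds 1/2,
   so there the maximum is [S]. *)
pose S' z := Num.max (S z) 2^-1.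
have S'0 z : 0 < S' z by rewrite lt_max invr_gt0 ltr0n orbT.
have cS' : bcont S' by apply: bcont_max => //; exact: bcont_cst.
exists s, (fun i z => g i z * (S' z)^-1); split.
- by move=> i /DK; rewrite inE.
- move=> i; apply: bcontM; first by have [] := gP i.
  split; first by move=> z; apply: cvgV; [rewrite gt_eqF|exact: cS'.1].
  exists 2 => z; rewrite ger0_norm ?invr_ge0 ?(ltW (S'0 z))//.
  rewrite -[leRHS]invrK lef_pV2 ?posrE ?invr_gt0//.
  by rewrite le_max lexx orbT.
- by move=> i z; rewrite mulr_ge0// invr_ge0 ltW.
- by move=> i z Niz; have [_ _ _ ->] := gP i; rewrite ?mul0r.
split=> z; rewrite -mulr_suml -/(S z).
  by rewrite ler_pdivrMr// mul1r le_max lexx.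
move=> /cov[i /= iD giz]; rewrite /S' max_l ?divff//.
  apply/lt0r_neq0/(@lt_le_trans _ _ (g i z)).
    by apply: lt_trans giz; rewrite invr_gt0.
  rewrite /S (big_rem i)//= lerDl; apply: sumr_ge0 => j _; exact: g0.
apply: (le_trans (ltW giz)); rewrite /S (big_rem i)//= lerDl.
by apply: sumr_ge0 => j _; exact: g0.
Qed.

(** * Integration of bounded continuous functions *)

Section mean.
Context {R : realType} {Z : ptopologicalType}.
Implicit Types (mu : borel_probability R Z) (f g : Z -> R).

Definition mean mu f : R := \int[mu]_(z in [set: borel Z]) f z.

Lemma continuous_measurable_real f : continuous f ->
  measurable_fun [set: borel Z] (f : borel Z -> R).
Proof.
move=> cf; apply: (measurability _ (RGenOpens.measurableE R)).
move=> _ [_ [a [b ->]] <-]; rewrite setTI; apply: sub_sigma_algebra.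
by move/continuousP : cf; apply; exact: interval_open.
Qed.

Lemma bcont_integrable mu f : bcont f ->
  mu.-integrable [set: borel Z] (EFin \o f).
Proof.
move=> cf; apply: measurable_bounded_integrable => //.
- by apply: le_lt_trans (probability_le1 mu measurableT) _; exact: ltry.
- exact: continuous_measurable_real cf.1.
- by have [_] := (bcont_bounded_fun f).1 cf.
Qed.

Lemma meanE mu f : bcont f ->
  (mean mu f)%:E = (\int[mu]_(z in [set: borel Z]) (f z)%:E)%E.
Proof.
by move=> cf; rewrite fineK//; apply: integrable_fin_num => //; exact: bcont_integrable.
Qed.

Lemma meanD mu f g : bcont f -> bcont g ->
  mean mu (fun z => f z + g z) = mean mu f + mean mu g.
Proof. by move=> cf cg; apply: RintegralD => //; exact: bcont_integrable. Qed.

Lemma meanZ mu (c : R) f : bcont f ->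
  mean mu (fun z => c * f z) = c * mean mu f.
Proof. by move=> cf; apply: RintegralZl => //; exact: bcont_integrable. Qed.

Lemma mean_ge0 mu f : (forall z, 0 <= f z) -> 0 <= mean mu f.
Proof. by move=> f0; apply: Rintegral_ge0. Qed.

Lemma mean_cst mu (c : R) : mean mu (fun=> c) = c.
Proof.
by rewrite /mean Rintegral_cst// [X in fine X]probability_setT mulr1.
Qed.

Lemma meanB mu f g : bcont f -> bcont g ->
  mean mu (fun z => f z - g z) = mean mu f - mean mu g.
Proof. by move=> cf cg; apply: RintegralB => //; exact: bcont_integrable. Qed.

Lemma le_mean mu f g : bcont f -> bcont g -> (forall z, f z <= g z) ->
  mean mu f <= mean mu g.
Proof. by move=> cf cg fg; apply: le_Rintegral => //; exact: bcont_integrable. Qed.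

Lemma normr_mean_le mu f (M : R) : bcont f -> (forall z, `|f z| <= M) ->
  `|mean mu f| <= M.
Proof.
move=> cf fM; have {}fM z : - M <= f z <= M by rewrite -ler_norml.
have bc (c : R) : bcont (fun _ : Z => c) by exact: bcont_cst.
rewrite ler_norml; apply/andP; split.
  by rewrite -[leLHS](mean_cst mu); apply: le_mean => // z; case/andP: (fM z).
by rewrite -[leRHS](mean_cst mu); apply: le_mean => // z; case/andP: (fM z).
Qed.

Lemma mean_sum mu (I : Type) (s : seq I) (P : pred I) (F : I -> Z -> R) :
  (forall i, bcont (F i)) ->
  mean mu (fun z => \sum_(i <- s | P i) F i z) = \sum_(i <- s | P i) mean mu (F i).
Proof.
move=> cF; elim: s => [|i s IH].
  by under eq_fun do rewrite big_nil; rewrite big_nil mean_cst.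
under eq_fun do rewrite big_cons; rewrite big_cons; case: (P i) => //.
by rewrite meanD ?IH//; exact: bcont_sum.
Qed.

End mean.

(* The functionals representable by Radon probability measures. *)
Record tight_functional (R : realType) (Z : ptopologicalType) := TightFunctional {
  tf_fun :> (Z -> R) -> R ;
  tfD : forall f g, bcont f -> bcont g ->
    tf_fun (fun z => f z + g z) = tf_fun f + tf_fun g ;
  tfZ : forall c f, bcont f -> tf_fun (fun z => c * f z) = c * tf_fun f ;
  tf_ge0 : forall f, bcont f -> (forall z, 0 <= f z) -> 0 <= tf_fun f ;
  tf1 : tf_fun (fun=> 1) = 1 ;
  tf_tight : forall e, 0 < e -> exists K : set Z, compact K /\
    forall f, bcont f -> (forall z, 0 <= f z <= 1) ->
      (forall z, K z -> f z = 0) -> tf_fun f <= e }.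

Section tight_functional_theory.
Context {R : realType} {Z : ptopologicalType} (L : tight_functional R Z).
Implicit Types f g : Z -> R.

Lemma tfN f : bcont f -> L (fun z => - f z) = - L f.
Proof.
move=> cf; rewrite -mulN1r -tfZ//; congr (tf_fun L).
by apply/funext => z; rewrite mulN1r.
Qed.

Lemma tfB f g : bcont f -> bcont g ->
  L (fun z => f z - g z) = L f - L g.
Proof. by move=> cf cg; rewrite -tfN// -tfD//; exact: bcontN. Qed.

Lemma tf_le f g : bcont f -> bcont g -> (forall z, f z <= g z) ->
  L f <= L g.
Proof.
move=> cf cg fg; rewrite -subr_ge0 -tfB//.
by apply: tf_ge0 => [|z]; [exact: bcontB|rewrite subr_ge0].
Qed.

Lemma tf_cst c : L (fun=> c) = c.
Proof.
rewrite -[RHS]mulr1 -(tf1 L) -tfZ; last exact: bcont_cst.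
by congr (tf_fun L); apply/funext => z; rewrite mulr1.
Qed.

Lemma tf_sum (I : Type) (s : seq I) (P : pred I) (F : I -> Z -> R) :
  (forall i, bcont (F i)) ->
  L (fun z => \sum_(i <- s | P i) F i z) = \sum_(i <- s | P i) L (F i).
Proof.
move=> cF; elim: s => [|i s IH].
  by under eq_fun do rewrite big_nil; rewrite big_nil tf_cst.
under eq_fun do rewrite big_cons; rewrite big_cons; case: (P i) => //.
by rewrite tfD ?IH//; exact: bcont_sum.
Qed.

End tight_functional_theory.

Lemma compact_borel (Z : ptopologicalType) (K : set Z) :
  hausdorff_space Z -> compact K -> measurable (K : set (borel Z)).
Proof.
move=> hZ /(compact_closed hZ) /closed_openC oK.
by rewrite -[K]setCK; apply: measurableC; apply: sub_sigma_algebra; exact: oK.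
Qed.

Lemma open_borel (Z : ptopologicalType) (U : set Z) :
  open U -> measurable (U : set (borel Z)).
Proof. by move=> oU; apply: sub_sigma_algebra; exact: oU. Qed.

(** * Riesz representation of tight functionals *)

Section riesz.
Context {R : realType} {Z : ptopologicalType} (L : tight_functional R Z).
Hypothesis bumpsZ : has_bumps R Z.
Implicit Types (f g : Z -> R) (U V : set Z) (e : R).

(** Vanishing off [U] replaces the compact support inside [U] of the locally compact Riesz theorem;
    tightness of [L] makes up for the missing compactness. *)
Definition below U f : Prop :=
  [/\ bcont f, forall z, 0 <= f z <= 1 & forall z, ~ U z -> f z = 0].

Definition open_mass U : \bar R := ereal_sup [set (L f)%:E | f in below U].

Definition outer_mass (A : set Z) : \bar R :=
  ereal_inf [set open_mass U | U in [set U | open U /\ A `<=` U]].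

Lemma open_mass_ge U f : below U f -> ((L f)%:E <= open_mass U)%E.
Proof. by move=> Uf; apply: ereal_sup_ubound; exists f. Qed.

Lemma open_mass_ge0 U : (0 <= open_mass U)%E.
Proof.
rewrite -[leLHS]/((0 : R)%:E) -[X in X%:E](tf_cst L 0).
by apply: open_mass_ge; split=> // [|z]; [exact: bcont_cst|rewrite lexx ler01].
Qed.

Lemma open_mass_le1 U : (open_mass U <= 1)%E.
Proof.
apply: ge_ereal_sup => _ [f [cf f01 _] <-]; rewrite lee_fin -(tf1 L).
by apply: tf_le => //; [exact: bcont_cst|move=> z; case/andP: (f01 z)].
Qed.

Lemma open_mass_fin U : open_mass U \is a fin_num.
Proof.
rewrite ge0_fin_numE ?open_mass_ge0//.
by apply: le_lt_trans (open_mass_le1 U) _; rewrite ltry.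
Qed.

Lemma open_mass_approx U e : 0 < e ->
  exists f, below U f /\ (open_mass U <= (L f + e)%:E)%E.
Proof.
move=> e0; have [_ [f Uf <-] Lf] := ub_ereal_sup_adherent e0 (open_mass_fin U).
by exists f; split=> //; rewrite EFinD -leeBlDr// ltW.
Qed.

Lemma le_open_mass U V : U `<=` V -> (open_mass U <= open_mass V)%E.
Proof.
move=> UV; apply: ge_ereal_sup => _ [f [cf f01 fU] <-]; apply: open_mass_ge.
by split=> // z nVz; apply: fU => /UV.
Qed.

Lemma outer_mass_le A U : open U -> A `<=` U -> (outer_mass A <= open_mass U)%E.
Proof. by move=> oU AU; apply: ereal_inf_lbound; exists U. Qed.

Lemma outer_mass_open U : open U -> outer_mass U = open_mass U.
Proof.
move=> oU; apply/eqP; rewrite eq_le outer_mass_le//=.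
by apply: le_ereal_inf_tmp => _ [V [oV UV] <-]; exact: le_open_mass.
Qed.

Lemma outer_mass_ge0 A : (0 <= outer_mass A)%E.
Proof.
by apply: le_ereal_inf_tmp => _ [V _ <-]; exact: open_mass_ge0.
Qed.

Lemma le_outer_mass A B : A `<=` B -> (outer_mass A <= outer_mass B)%E.
Proof.
move=> AB; apply: le_ereal_inf_tmp => _ [V [oV BV] <-].
by apply: outer_mass_le => //; exact: subset_trans BV.
Qed.

Lemma outer_mass_fin A : outer_mass A \is a fin_num.
Proof.
rewrite ge0_fin_numE ?outer_mass_ge0//.
apply: le_lt_trans (outer_mass_le openT (@subsetT _ A)) _.
by apply: le_lt_trans (open_mass_le1 _) _; rewrite ltry.
Qed.

Lemma outer_mass_approx A e : 0 < e ->
  exists U, [/\ open U, A `<=` U & (open_mass U <= outer_mass A + e%:E)%E].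
Proof.
move=> e0.
have [_ [U [oU AU] <-] mU] := lb_ereal_inf_adherent e0 (outer_mass_fin A).
by exists U; split=> //; exact: ltW.
Qed.

Lemma outer_mass0 : outer_mass set0 = 0%E.
Proof.
rewrite outer_mass_open; last exact: open0.
apply/eqP; rewrite eq_le open_mass_ge0 andbT.
apply: ge_ereal_sup => _ [f [cf _ f0] <-].
have -> : f = fun=> 0 by apply/funext => z; apply: f0.
by rewrite tf_cst.
Qed.

Lemma outer_massT : outer_mass setT = 1%E.
Proof.
rewrite outer_mass_open; last exact: openT.
apply/eqP; rewrite eq_le open_mass_le1/= -[leLHS]/((1 : R)%:E) -[X in X%:E](tf1 L).
apply: open_mass_ge; split=> [|z|z]; [exact: bcont_cst| |by case].
by rewrite lexx ler01.
Qed.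

(** This is where tightness of [L] enters. Up to mass [e] off a compact [K] and values of [f] below
    [e], the function [f] lives on the compact [C], which finitely many [U_ n] cover. A partition of
    unity on [C] dominates [f] there and splits into pieces below the [U_ n]. *)
Lemma open_mass_bigcup (U_ : nat -> set Z) : (forall n, open (U_ n)) ->
  (open_mass (\bigcup_n U_ n) <= \sum_(n <oo) open_mass (U_ n))%E.
Proof.
move=> oU; apply: ge_ereal_sup => _ [f [cf f01 fU] <-].
apply/lee_addgt0Pr => e' e'0; pose e := e' / 2.
have e0 : 0 < e by rewrite divr_gt0.
have [K [cK LK]] := tf_tight L e0.
pose C := K `&` [set z | e <= f z].
have cC : compact C.
  apply: compact_closedI => //.
  by move/continuous_closedP : cf.1 => /(_ _ (@closed_ge _ e)).
have /choice[idx idxP] : forall z, exists n, C z -> U_ n z.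
  move=> z; have [[Kz /= efz]|nC] := pselect (C z); last by exists 0%N.
  have [[n _ Unz]|nU] := pselect ((\bigcup_n U_ n) z); first by exists n.
  by move: efz; rewrite fU// leNgt e0.
have [|s [phi [sC cphi phi0 phiN [phi1 phiC]]]] :=
    subordinate_bumps (K := C) (N := U_ \o idx) bumpsZ cC.
  by move=> z Cz; apply: open_nbhs_nbhs; split; [exact: oU|exact: idxP].
pose g z := \sum_(i <- s) phi i z.
have cg : bcont g by exact: bcont_sum.
have g0 z : 0 <= g z by apply: sumr_ge0.
(* The excess of [f] over [g + e] vanishes on [K]: there either [f < e], or the point lies in [C]
   and [g = 1]. Tightness then bounds [L r] by [e]. *)
pose r z := Num.max (f z - g z - e) 0.
have cr : bcont r.
  apply: bcont_max; last exact: bcont_cst.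
  by do 2?[apply: bcontB] => //; exact: bcont_cst.
have Lr : L r <= e.
  apply: LK => // z.
    rewrite /r le_max lexx orbT/= ge_max ler01 andbT.
    by have := f01 z; have := g0 z; lra.
  move=> Kz; rewrite /r max_r// lerBlDr add0r.
  have [efz|] := leP e (f z); last by have := g0 z; lra.
  by rewrite /g phiC//; have := f01 z; lra.
have Lf : L f <= L g + e'.
  have -> : e' = L r + e + (e - L r) by rewrite /e; lra.
  have <- := tf_cst L e.
  rewrite (@le_trans _ _ (L (fun z => g z + (r z + e))))//.
    apply: tf_le => //; first by do 2!apply: bcontD => //; exact: bcont_cst.
    move=> z; suff : f z - g z - e <= r z by lra.
    by rewrite /r le_max lexx.
  rewrite tfD//; last by apply: bcontD => //; exact: bcont_cst.
  rewrite tfD//; last exact: bcont_cst.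
  by rewrite tf_cst; move: Lr; lra.
rewrite (@le_trans _ _ ((L g)%:E + e'%:E)%E)// leeD2r//.
(* The bumps are grouped by the index of the open set that contains them; [n] exceeds all indices
   occurring in [s], so [inord] does not alter them. *)
pose n := (\max_(i <- s) idx i).+1.
pose G (k : 'I_n) z := \sum_(i <- s | (inord (idx i) : 'I_n) == k) phi i z.
have cG k : bcont (G k) by exact: bcont_sum.
have -> : g = fun z => \sum_(k < n) G k z.
  apply/funext => z; rewrite /g.
  exact: (partition_big (fun i => inord (idx i) : 'I_n) xpredT).
rewrite tf_sum// -sumEFin.
rewrite (@le_trans _ _ (\sum_(k < n) open_mass (U_ k))%E)//; last first.
  rewrite -(big_mkord xpredT (fun k => open_mass (U_ k))).
  by apply: nneseries_lim_ge => k _ _; exact: open_mass_ge0.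
apply: lee_sum => k _; apply: open_mass_ge; split=> // z.
  rewrite sumr_ge0//= (le_trans _ (phi1 z))//.
  by rewrite [leRHS](bigID (fun i => (inord (idx i) : 'I_n) == k))/= lerDl sumr_ge0.
move=> nUk; rewrite /G big_seq_cond big1// => i /andP[si /eqP ik].
apply: phiN => /=; rewrite (_ : idx i = k)//.
by rewrite -ik inordK// ltnS leq_bigmax_seq.
Qed.

Lemma outer_mass_sigma_subadditive : sigma_subadditive outer_mass.
Proof.
move=> A; apply/lee_addgt0Pr => e e0.
have /choice[U UP] : forall n, exists U, [/\ open U, A n `<=` U &
    (open_mass U <= outer_mass (A n) + (e / (2 ^ n.+1)%:R)%:E)%E].
  by move=> n; apply: outer_mass_approx; rewrite divr_gt0// ltr0n expn_gt0.
have oU n : open (U n) by have [] := UP n.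
apply: (@le_trans _ _ (open_mass (\bigcup_n U n))).
  apply: outer_mass_le; first by apply: bigcup_open => n _; exact: oU.
  by apply: subset_bigcup => n _; have [] := UP n.
apply: (le_trans (open_mass_bigcup oU)).
apply: le_trans (epsilon_trick _ _ (ltW e0)); last first.
  by move=> n; exact: outer_mass_ge0.
apply: lee_nneseries => [n _ _|n _]; first exact: open_mass_ge0.
by have [] := UP n.
Qed.

(** Caratheodory's condition for open sets. If [f] nearly exhausts the mass of [V] inside [U], then
    the part of [V] outside [U] lies in the open set [W] where [f < e / 3]. Lowering [f] by [e / 3]
    makes it vanish on [W], so its sum with a function below [W] never exceeds 1 and is below
    [V]. *)
Lemma open_mass_split U V e : open U -> open V -> 0 < e ->
  (outer_mass (V `&` U) + outer_mass (V `&` ~` U) <= open_mass V + e%:E)%E.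
Proof.
move=> oU oV e0; have e30 : 0 < e / 3 by rewrite divr_gt0.
have [f [[cf f01 fVU] Lf]] := open_mass_approx (V `&` U) e30.
pose W := V `&` [set z | f z < e / 3].
have oW : open W.
  by apply: openI => //; move/continuousP : cf.1 => /(_ _ (@open_lt _ (e / 3))).
have [g [[cg g01 gW] Lg]] := open_mass_approx W e30.
pose f' z := Num.max (f z - e / 3) 0.
have cf' : bcont f'.
  by apply: bcont_max; [apply: bcontB => //|]; exact: bcont_cst.
have Lf' : L f <= L f' + e / 3.
  rewrite -[X in _ + X](tf_cst L) -tfD//; last exact: bcont_cst.
  apply: tf_le => //; first by apply: bcontD => //; exact: bcont_cst.
  by move=> z; rewrite /f' -lerBlDr le_max lexx.
have fgV : below V (fun z => f' z + g z).
  split; first exact: bcontD.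
    move=> z; rewrite /f'; have [Wz|/gW ->] := pselect (W z).
      rewrite max_r; last by case: Wz => _ /=; lra.
      by rewrite add0r; exact: g01.
    by rewrite addr0 le_max lexx orbT/= ge_max ler01 andbT; have := f01 z; lra.
  move=> z nVz; rewrite gW ?addr0; last by case.
  by rewrite /f' fVU ?max_r//; [lra|case].
have le1 : (outer_mass (V `&` U) <= (L f + e / 3)%:E)%E.
  by rewrite outer_mass_open//; exact: openI.
have le2 : (outer_mass (V `&` ~` U) <= (L g + e / 3)%:E)%E.
  apply: le_trans Lg; apply: outer_mass_le => // z [Vz nUz]; split=> //=.
  by rewrite fVU//; case.
apply: (le_trans (leeD le1 le2)).
have := open_mass_ge fgV; rewrite tfD// => /(leeD2r e%:E); apply: le_trans.
by rewrite -!EFinD lee_fin; lra.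
Qed.

Lemma open_outer_measurable U : open U -> forall X,
  (outer_mass (X `&` U) + outer_mass (X `&` ~` U) <= outer_mass X)%E.
Proof.
move=> oU X; apply/lee_addgt0Pr => e e0.
have e20 : 0 < e / 2 by rewrite divr_gt0.
have [V [oV XV mV]] := outer_mass_approx X e20.
rewrite [e]splitr EFinD addeA; apply: le_trans (leeD2r _ mV).
apply: le_trans (open_mass_split oU oV e20).
by apply: leeD; apply: le_outer_mass; exact: setSI.
Qed.

End riesz.

(** The layer-cake decomposition in unit layers, with continuous layers in place of indicators. *)
Lemma sum_clamp (R : realType) (t : R) (n : nat) : 0 <= t ->
  \sum_(k < n) Num.max (Num.min (t - k%:R) 1) 0 = Num.min t n%:R.
Proof.
move=> t0; elim: n => [|n IH]; first by rewrite big_ord0 min_r.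
rewrite big_ord_recr/= IH -natr1.
by case: (leP t n%:R) => h1; case: (leP (t - n%:R) 1) => h2;
  case: (leP t (n%:R + 1)) => h3; rewrite /Num.max; case: ifPn => h4; lra.
Qed.

Lemma prob_le_mean (R : realType) (Z : ptopologicalType)
    (P : borel_probability R Z) (B : set (borel Z)) (g : Z -> R) :
  measurable B -> bcont g -> (forall z, 0 <= g z) ->
  (forall z, B z -> 1 <= g z) -> (P B <= (mean P g)%:E)%E.
Proof.
move=> mB cg g0 gB; rewrite meanE// -[B]setIT -integral_indic//.
apply: ge0_le_integral => //.
- by apply/measurable_EFinP; exact: measurable_indic.
- by apply/measurable_EFinP; exact: continuous_measurable_real cg.1.
- move=> z _; rewrite lee_fin indicE; have [/set_mem/gB//|_] := boolP (z \in B).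
  exact: g0.
Qed.

Section riesz_measure.
Context {R : realType} {Z : ptopologicalType} (L : tight_functional R Z).
Hypothesis bumpsZ : has_bumps R Z.

Lemma outer_mass_probability :
  exists P : borel_probability R Z, forall B, P B = outer_mass L B.
Proof.
pose mO := isOuterMeasure.Build R Z (outer_mass L) (outer_mass0 L)
  (outer_mass_ge0 L) (@le_outer_mass _ _ L)
  (outer_mass_sigma_subadditive L bumpsZ).
pose O : {outer_measure set Z -> \bar R} := HB.pack (outer_mass L) mO.
have borelO (B : set (borel Z)) : measurable B -> O.-cara.-measurable B.
  move=> mB; apply: (smallest_sub (sigma_algebra_measurable (caratheodory_type O))) mB.
  by move=> U oU; apply: le_caratheodory_measurable; exact: open_outer_measurable.
have additiveO : semi_sigma_additive (outer_mass L : set (borel Z) -> \bar R).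
  move=> A mA tA mUA; apply: (caratheodory_measure_sigma_additive (mu := O)) => //.
    by move=> n; exact: borelO.
  exact: borelO.
pose mM := isMeasure.Build _ (borel Z) R (outer_mass L) (outer_mass0 L)
  (outer_mass_ge0 L) additiveO.
pose M : {measure set (borel Z) -> \bar R} := HB.pack (outer_mass L) mM.
pose mP := Measure_isProbability.Build _ (borel Z) R M (outer_massT L).
by exists (HB.pack_for (probability (borel Z) R) (outer_mass L) mM mP).
Qed.

Lemma riesz_radon : hausdorff_space Z -> exists P : borel_probability R Z,
  radon P /\ forall f, bcont f -> mean P f = L f.
Proof.
move=> hZ; have [P PE] := outer_mass_probability; exists P; split.
  move=> B e mB e0; have e20 : 0 < e / 2 by rewrite divr_gt0.
  have [U [oU BU mU]] := outer_mass_approx L (~` B) e20.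
  have e40 : 0 < e / 4 by rewrite divr_gt0.
  have [K [cK LK]] := tf_tight L e40.
  have mK := compact_borel hZ cK.
  (* The open [U] contains the complement of [B] and exceeds it by at most [e / 2], so what [B]
     loses lies off [K] (mass at most [e / 4]) or in the part of [B] inside [U] (mass at most
     [e / 2]). The sum is strictly below [e], as [radon] demands. *)
  exists (K `&` ~` U); split.
  - by apply: compact_closedI => //; exact: open_closedC.
  - by move=> z [_ nUz]; apply: contrapT => nBz; apply: nUz; exact: BU.
  have PU : (P (U `&` B) <= (e / 2)%:E)%E.
    have : (P (~` B) + P (U `&` B) <= P (~` B) + (e / 2)%:E)%E.
      rewrite -measureU//; first last.
      - by apply/seteqP; split=> z //= -[nB [_ ?]].
      - by apply: measurableI => //; exact: open_borel.
      - exact: measurableC.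
      rewrite [X in (_ <= X + _)%E]PE; apply: le_trans mU.
      rewrite -outer_mass_open// -PE; apply: le_measure; rewrite ?inE.
      - apply: measurableU; first exact: measurableC.
        by apply: measurableI => //; exact: open_borel.
      - exact: open_borel.
      - by move=> z [/BU//|[]].
    by rewrite leeD2lE//; exact: fin_num_measure (measurableC mB).
  have PK : (P (~` K) <= (e / 4)%:E)%E.
    rewrite PE outer_mass_open; last exact: closed_openC (compact_closed hZ cK).
    apply: ge_ereal_sup => _ [f [cf f01 fK] <-]; rewrite lee_fin.
    by apply: LK => // z Kz; apply: fK; exact.
  apply: (@le_lt_trans _ _ (P (~` K `|` (U `&` B)))).
    apply: le_measure; rewrite ?inE.
    + apply: measurableD => //; apply: measurableI => //.
      by apply: measurableC; exact: open_borel.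
    + apply: measurableU; first exact: measurableC.
      by apply: measurableI => //; exact: open_borel.
    + move=> z [Bz nKU]; have [Kz|] := pselect (K z); last by left.
      by right; split=> //; apply: contrapT => nUz; apply: nKU.
  apply: (@le_lt_trans _ _ (P (~` K) + P (U `&` B))%E).
    apply: measureU2; first exact: measurableC.
    by apply: measurableI => //; exact: open_borel.
  by apply: le_lt_trans (leeD PK PU) _; rewrite -EFinD lte_fin; lra.
(* Cut [n f] into layers [g k]. The layer [g k.+1] is below [U k.+1], on which [g k] equals 1, so
   [P (U k.+1)] separates [L (g k.+1)] from [mean P (g k)]. Shifting the sum by one layer costs
   [L (g 0) / n], at most [1 / n <= e]. *)
have le_mean f : bcont f -> (forall z, 0 <= f z <= 1) -> L f <= mean P f.
  move=> cf f01; apply/ler_addgt0Pr => e e0.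
  pose n := (Num.truncn e^-1).+1.
  have n0 : 0 < n%:R :> R by rewrite ltr0n.
  have ne : n%:R^-1 <= e.
    by rewrite -[leRHS]invrK lef_pV2 ?posrE ?invr_gt0// ltW// truncnS_gt.
  pose g (k : nat) z := Num.max (Num.min (n%:R * f z - k%:R) 1) 0.
  have cg k : bcont (g k).
    rewrite /g; apply: bcont_max; last exact: bcont_cst.
    rewrite (_ : (fun z => _) = fun z => - Num.max (- (n%:R * f z - k%:R)) (-1)).
      apply: bcontN; apply: bcont_max; last exact: bcont_cst.
      apply: bcontN; apply: bcontB; last exact: bcont_cst.
      exact: bcontZ.
    by apply/funext => z; rewrite -oppr_min opprK.
  have g01 k z : 0 <= g k z <= 1.
    by rewrite /g le_max lexx orbT/= ge_max ler01 andbT ge_min lexx orbT.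
  have fE z : f z = n%:R^-1 * \sum_(k < n) g k z.
    case/andP: (f01 z) => f0 f1.
    rewrite sum_clamp; last by rewrite mulr_ge0// ltW.
    by rewrite min_l ?mulKf ?gt_eqF// -[leRHS]mulr1 ler_pM2l.
  pose U k := [set z | k%:R < n%:R * f z].
  have oU k : open (U k).
    have /continuousP : continuous (fun z => n%:R * f z) by case: (bcontZ n%:R cf).
    by move=> /(_ _ (@open_gt _ k%:R)).
  have gU k : below (U k) (g k).
    split=> // z /negP; rewrite -leNgt => h.
    by rewrite /g max_r// ge_min subr_le0 h.
  have Lg k : ((L (g k))%:E <= P (U k))%E.
    by rewrite PE outer_mass_open//; exact: open_mass_ge.
  have Pg k : (P (U k.+1) <= (mean P (g k))%:E)%E.
    apply: prob_le_mean => [|//|z|z]; [exact: open_borel|by case/andP: (g01 k z)|].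
    rewrite /U /g /= -natr1 => h; rewrite le_max min_r ?lexx//.
    by rewrite lerBrDl ltW.
  have Lgk k : L (g k.+1) <= mean P (g k).
    by rewrite -lee_fin; exact: le_trans (Lg _) (Pg _).
  have Lg0 : L (g 0%N) <= 1.
    rewrite -lee_fin; apply: (le_trans (Lg _)).
    exact: (probability_le1 P (open_borel (oU _))).
  have -> : L f = n%:R^-1 * \sum_(k < n) L (g k).
    rewrite -tf_sum// -tfZ; last exact: bcont_sum.
    by congr (tf_fun L); apply/funext.
  have -> : mean P f = n%:R^-1 * \sum_(k < n) mean P (g k).
    rewrite -mean_sum// -meanZ; last exact: bcont_sum.
    by congr (mean P); apply/funext.
  apply: (@le_trans _ _ (n%:R^-1 * (1 + \sum_(k < n) mean P (g k)))); last first.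
    by rewrite mulrDr mulr1 addrC lerD2l.
  rewrite ler_pM2l ?invr_gt0// big_ord_recl lerD// big_ord_recr/=.
  rewrite (@le_trans _ _ (\sum_(k < n.-1) mean P (g k)))//.
    by apply: ler_sum => k _; exact: Lgk.
  by rewrite lerDl; apply: mean_ge0 => z; case/andP: (g01 n.-1 z).
(* The inequality applied to [1 - f] is the reverse one, because both functionals take the value 1
   at the constant 1. *)
have mean_unit f : bcont f -> (forall z, 0 <= f z <= 1) -> mean P f = L f.
  move=> cf f01; apply/eqP; rewrite eq_le le_mean// andbT.
  have c1 : bcont (fun _ : Z => 1 : R) by exact: bcont_cst.
  have := le_mean _ (bcontB c1 cf).
  rewrite tfB// meanB// tf_cst mean_cst lerD2l lerN2; apply.
  by move=> z; have := f01 z; lra.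
move=> f cf; have [_ [M fM]] := cf.
pose m := `|M| + 1; have m0 : 0 < m by rewrite ltr_wpDl.
pose g z := (2 * m)^-1 * (f z + m).
have cm : bcont (fun _ : Z => m) by exact: bcont_cst.
have fE : f = fun z => (2 * m) * g z - m.
  by apply/funext => z; rewrite /g mulVKf ?addrK// mulf_neq0// gt_eqF.
have cg : bcont g by apply: bcontZ; exact: bcontD.
rewrite fE tfB ?meanB//; try exact: bcontZ.
rewrite tfZ// meanZ// tf_cst mean_cst mean_unit// => z.
have : `|f z| <= m by rewrite (le_trans (fM z))// (le_trans (ler_norm M))// lerDl.
rewrite ler_norml => /andP[h1 h2]; rewrite /g mulrC divr_ge0 ?ler_pdivrMr//=; lra.
Qed.
End riesz_measure.

(** * Comparison of integrals over compact sets *)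

Section comparison.
Context {R : realType} {Z : ptopologicalType}.
Variable P : borel_probability R Z.

(* [g] need not be measurable: its integral is then a lower integral. *)
Lemma integral_compare (f g : Z -> R) (K : set (borel Z)) (M eta delta : R) :
  measurable_fun [set: borel Z] (f : borel Z -> R) ->
  (forall z, 0 <= f z <= M) -> (forall z, 0 <= g z) -> measurable K ->
  (forall z, K z -> f z <= g z + eta) -> 0 <= eta ->
  (P (~` K) <= delta%:E)%E ->
  (\int[P]_(z in [set: borel Z]) (f z)%:E <=
   \int[P]_(z in [set: borel Z]) (g z)%:E + (eta + M * delta)%:E)%E.
Proof.
move=> mf fM g0 mK fg eta0 PK.
have M0 : 0 <= M by case/andP: (fM point); exact: le_trans.
(* A measurable minorant of [g]: every simple function below [k] is below [g], which bounds the
   lower integral of [g] from below. *)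
pose k z := Num.max (f z - eta) 0 * (\1_K z : R).
have mk : measurable_fun [set: borel Z] (k : borel Z -> R).
  apply: measurable_funM; last exact: measurable_indic.
  by apply: measurable_maxr => //; apply: measurable_funB.
have k0 z : 0 <= k z by rewrite mulr_ge0// le_max lexx orbT.
have kg : (\int[P]_(z in [set: borel Z]) (k z)%:E <=
    \int[P]_(z in [set: borel Z]) (g z)%:E)%E.
  rewrite !ge0_integralTE//; try by move=> z; rewrite lee_fin.
  apply: le_ereal_sup => _ [s /= sk <-]; exists s => //= z.
  apply: (le_trans (sk z)); rewrite lee_fin /k indicE.
  have [/set_mem Kz|_] := boolP (z \in K); last by rewrite mulr0.
  by rewrite mulr1 ge_max g0 andbT lerBlDr fg.
have mnK : measurable (~` K) by exact: measurableC.
apply: (@le_trans _ _ (\int[P]_(z in [set: borel Z])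
    ((k z)%:E + (eta%:E + M%:E * (\1_(~` K) z)%:E)))%E).
  apply: ge0_le_integral => //.
  - by move=> z _; rewrite lee_fin; case/andP: (fM z).
  - exact/measurable_EFinP.
  - apply: emeasurable_funD; first exact/measurable_EFinP.
    apply: emeasurable_funD => //.
    by apply: measurable_funeM; apply/measurable_EFinP; exact: measurable_indic.
  move=> z _; rewrite -!EFinM -!EFinD lee_fin /k !indicE in_setC.
  have [Kz|_] := boolP (z \in K); rewrite /= ?mulr1 ?mulr0 ?addr0 ?add0r.
    by rewrite -lerBlDr le_max lexx.
  by case/andP: (fM z) => _ /le_trans; apply; rewrite lerDr.
rewrite ge0_integralD//; last 4 first.
- by move=> z _; rewrite lee_fin.
- exact/measurable_EFinP.
- by move=> z _; rewrite adde_ge0// lee_fin// mulr_ge0.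
- apply: emeasurable_funD => //.
  by apply: measurable_funeM; apply/measurable_EFinP; exact: measurable_indic.
apply: leeD => //.
rewrite ge0_integralD//; last 2 first.
- by move=> z _; rewrite lee_fin mulr_ge0.
- by apply: measurable_funeM; apply/measurable_EFinP; exact: measurable_indic.
rewrite integral_cst// [X in (_ * X)%E]probability_setT mule1 EFinD leeD2l//.
rewrite ge0_integralZl//; last by apply/measurable_EFinP; exact: measurable_indic.
by rewrite integral_indic// setIT EFinM lee_wpmul2l.
Qed.

(** Only the positive part of [f - g] is estimated, so bounds from one side suffice; with [g]
    constant this is also the test for smallness of a mean. *)
Lemma mean_compare (f g : Z -> R) (K : set (borel Z)) (M eta delta : R) :
  bcont f -> bcont g -> (forall z, f z <= g z + M) -> 0 <= M -> measurable K ->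
  (forall z, K z -> f z <= g z + eta) -> 0 <= eta ->
  (P (~` K) <= delta%:E)%E ->
  mean P f <= mean P g + (eta + M * delta).
Proof.
move=> cf cg fM M0 mK fg eta0 PK; rewrite -lerBlDl -meanB//.
pose r z := Num.max (f z - g z) 0.
have cr : bcont r by apply: bcont_max; [exact: bcontB|exact: bcont_cst].
rewrite (@le_trans _ _ (mean P r))//.
  by apply: le_mean => [||z] //; [exact: bcontB|rewrite le_max lexx].
rewrite -lee_fin meanE//.
have := @integral_compare r (fun=> 0) K M eta delta.
rewrite integral0 add0e; apply=> //; first exact: continuous_measurable_real cr.1.
  by move=> z; rewrite le_max lexx orbT/= ge_max M0 lerBlDl fM.
by move=> z Kz; rewrite ge_max add0r eta0 andbT lerBlDl fg.
Qed.

Lemma radon_tight (e : R) : radon P -> 0 < e ->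
  exists K : set Z, compact K /\ (P (~` K) <= e%:E)%E.
Proof.
move=> rP e0; have [K [cK _ PK]] := rP setT e measurableT e0.
by exists K; split=> //; rewrite -setTD ltW.
Qed.

Lemma mean_tight : hausdorff_space Z -> radon P ->
  forall (M e : R), 0 < e -> exists K : set Z, compact K /\
    forall f, bcont f -> (forall z, 0 <= f z <= M) ->
      (forall z, K z -> f z = 0) -> mean P f <= e.
Proof.
move=> hZ rP M e e0; have m0 : 0 < `|M| + 1 by rewrite ltr_wpDl.
have [K [cK PK]] := radon_tight rP (divr_gt0 e0 m0).
exists K; split=> // f cf fM fK.
have := @mean_compare f (fun=> 0) K (`|M| + 1) 0 (e / (`|M| + 1)) cf (bcont_cst _).
rewrite mean_cst !add0r mulrCA divff ?gt_eqF// mulr1; apply=> //.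
- move=> z; case/andP: (fM z) => _ /le_trans; apply.
  by rewrite (le_trans (ler_norm M))// lerDl.
- exact: compact_borel.
- by move=> z /fK ->.
Qed.

End comparison.

(** The tube lemma for oscillation, a substitute for uniform continuity without a metric. The
    estimate holds on an open neighbourhood of [K], not just on [K], because bumps subordinate to a
    cover of [K] live on such a neighbourhood. *)
Lemma compact_tube (R : realType) (X Y : ptopologicalType) (f : X * Y -> R)
    (K : set Y) (x : X) (e : R) :
  continuous f -> compact K -> 0 < e ->
  exists (A : set X) (W : set Y), [/\ nbhs x A, open W, K `<=` W &
    forall x' y, A x' -> W y -> `|f (x, y) - f (x', y)| <= e].
Proof.
move=> cf cK e0; have e20 : 0 < e / 2 by rewrite divr_gt0.
have /choice[AB ABP] : forall y, exists AB : set X * set Y,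
    [/\ nbhs x AB.1, open AB.2, AB.2 y &
      forall x' y', AB.1 x' -> AB.2 y' -> `|f (x, y') - f (x', y')| <= e].
  move=> y; have /cvgrPdist_le /(_ _ e20)[[A B] /= [xA yB] AB] := cf (x, y).
  exists (A, B^°); split=> //=; first exact: open_interior.
  move=> x' y' Ax' /interior_subset By'.
  have xy' : `|f (x, y) - f (x, y')| <= e / 2.
    by apply: (AB (x, y')); split=> //; exact: nbhs_singleton.
  have x'y' : `|f (x, y) - f (x', y')| <= e / 2 by exact: (AB (x', y')).
  by move: xy' x'y'; rewrite !ler_norml; lra.
move: cK; rewrite compact_cover => /(_ _ K (fun y => (AB y).2))[||D DK cov].
- by move=> y _; have [] := ABP y.
- by move=> y Ky; exists y => //; have [] := ABP y.
exists (\bigcap_(y in [set` D]) (AB y).1), (\bigcup_(y in [set` D]) (AB y).2).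
split=> //.
- by apply: filter_bigI => y _; have [] := ABP y.
- by apply: bigcup_open => y _; have [] := ABP y.
- by move=> x' y' Ax' [y Dy By']; have [_ _ _] := ABP y; apply=> //; exact: Ax'.
Qed.

(** * Plans and their marginals *)

Lemma continuous_measurable_borel (W X : ptopologicalType) (p : W -> X) :
  continuous p -> measurable_fun [set: borel W] (p : borel W -> borel X).
Proof.
move=> cp; apply: (measurability _ (erefl : @measurable _ (borel X) = <<s @open X>>)).
move=> _ [U oU <-]; rewrite setTI; apply: open_borel.
by move/continuousP : cp => /(_ _ oU).
Qed.

(** Bounded continuous functions determine Radon measures, here the image of [pi] under [p]. A
    compact [K] nearly filling the preimage of [A] has a compact image [C] inside [A], and a compact
    [D] nearly fills the complement of [C]. A sum of bumps equal to 1 on [C] and 0 on [D] then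
    yields one inequality up to [e]; the complement of [A] yields the other. *)
Lemma radon_pushforward (R : realType) (W X : ptopologicalType) (p : W -> X)
    (pi : borel_probability R W) (mu : borel_probability R X) :
  has_bumps R X -> hausdorff_space W -> hausdorff_space X -> continuous p ->
  radon pi -> radon mu ->
  (forall phi, bcont phi -> mean pi (phi \o p) = mean mu phi) ->
  forall A : set (borel X), measurable A -> pi (p @^-1` A) = mu A.
Proof.
move=> bX hW hX cp rpi rmu pimu.
have mp : measurable_fun [set: borel W] (p : borel W -> borel X).
  exact: continuous_measurable_borel.
have mpA (A : set (borel X)) : measurable A ->
    measurable (p @^-1` A : set (borel W)).
  by move=> mA; rewrite -[X in measurable X]setTI; exact: mp.
have piA (A : set (borel X)) : measurable A -> (pi (p @^-1` A) <= mu A)%E.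
  move=> mA; apply/lee_addgt0Pr => e e0.
  have e20 : 0 < e / 2 by rewrite divr_gt0.
  have [K [cK KA piK]] := rpi _ _ (mpA _ mA) e20.
  have mK := compact_borel hW cK.
  pose C := p @` K.
  have cC : compact C.
    by apply: continuous_compact => //; exact: continuous_subspaceT.
  have mC := compact_borel hX cC.
  have [D [cD DC muD]] := rmu _ _ (measurableC mC) e20.
  have mD := compact_borel hX cD.
  have oD : open (~` D) by exact: closed_openC (compact_closed hX cD).
  have [|s [phi [sC cphi phi0 phiN [phi1 phiC]]]] :=
      subordinate_bumps (K := C) (N := fun=> ~` D) bX cC.
    move=> z Cz; apply: open_nbhs_nbhs; split=> // Dz; exact: (DC z).
  pose g x := \sum_(i <- s) phi i x.
  have cg : bcont g by exact: bcont_sum.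
  have g0 x : 0 <= g x by apply: sumr_ge0.
  have muDC : (mu (~` D) <= mu A + (e / 2)%:E)%E.
    rewrite (@le_trans _ _ (mu C + mu (~` C `\` D))%E)//.
      rewrite (_ : ~` D = C `|` (~` C `\` D)); last first.
        apply/seteqP; split=> x.
          by move=> nDx; have [?|nCx] := pselect (C x); [left|right].
        by move=> [Cx Dx|[]//]; exact: DC Dx Cx.
      apply: measureU2 => //; apply: measurableD => //; exact: measurableC.
    apply: leeD; last exact: ltW.
    by apply: le_measure; rewrite ?inE// => x [w Kw <-]; exact: KA.
  have gD : ((mean mu g)%:E <= mu (~` D))%E.
    have fD : mu (~` D) \is a fin_num by apply: fin_num_measure; exact: measurableC.
    rewrite -(fineK fD) lee_fin.
    have := @mean_compare R X mu g (fun=> 0) D 1 0 (fine (mu (~` D))) cg (bcont_cst _).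
    rewrite mean_cst !add0r mul1r fineK//; apply=> //.
    by move=> x Dx; rewrite /g big1// => i _; apply: phiN; exact.
  have piKg : (pi K <= (mean mu g)%:E)%E.
    rewrite -pimu//; apply: prob_le_mean => // [|w|w Kw]; first exact: bcont_comp.
      exact: g0.
    by rewrite /= /g phiC//; exists w.
  rewrite [e]splitr EFinD addeA.
  apply: (@le_trans _ _ (pi K + pi (p @^-1` A `\` K))%E).
    rewrite -measureU//; last 2 first.
    - exact: measurableD (mpA _ mA) mK.
    - by apply/seteqP; split=> // w [Kw [_]].
    by rewrite setDUK.
  apply: leeD; last exact: ltW.
  exact: le_trans piKg (le_trans gD muDC).
move=> A mA; apply/eqP; rewrite eq_le piA//=.
have := piA _ (measurableC mA); rewrite preimage_setC.
rewrite !probability_setC//; last exact: mpA.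
by rewrite leeD2lE// leeN2.
Qed.

Lemma hausdorff_prod (X Y : topologicalType) :
  hausdorff_space X -> hausdorff_space Y -> hausdorff_space (X * Y)%type.
Proof.
move=> hX hY [x y] [x' y'] pq; congr (_, _).
- apply: hX => A B Ax Bx'.
  have [||w [Aw Bw]] := pq (fst @^-1` A) (fst @^-1` B); last by exists w.1.
    by exists (A, setT); [split=> //; exact: filterT|case=> ? ? []].
  by exists (B, setT); [split=> //; exact: filterT|case=> ? ? []].
- apply: hY => A B Ay By'.
  have [||w [Aw Bw]] := pq (snd @^-1` A) (snd @^-1` B); last by exists w.2.
    by exists (setT, A); [split=> //; exact: filterT|case=> ? ? []].
  by exists (setT, B); [split=> //; exact: filterT|case=> ? ? []].
Qed.

Lemma fst_continuous (X Y : topologicalType) : continuous (@fst X Y).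
Proof. by case=> x y; exact: cvg_fst. Qed.

Lemma snd_continuous (X Y : topologicalType) : continuous (@snd X Y).
Proof. by case=> x y; exact: cvg_snd. Qed.

Section plans_theory.
Context {R : realType} {X Y : ptopologicalType}.
Hypotheses (bX : has_bumps R X) (bY : has_bumps R Y).
Hypotheses (hX : hausdorff_space X) (hY : hausdorff_space Y).
Variables (mu : borel_probability R X) (nu : borel_probability R Y).
Implicit Types sigma : borel_probability R (X * Y)%type.

Lemma plans_mean sigma : radon mu -> radon nu -> radon sigma ->
  (forall phi, bcont phi -> mean sigma (phi \o fst) = mean mu phi) ->
  (forall psi, bcont psi -> mean sigma (psi \o snd) = mean nu psi) ->
  plans mu nu sigma.
Proof.
move=> rmu rnu rsigma s1 s2; split=> // [A mA|B mB].
  rewrite (_ : A `*` [set: Y] = fst @^-1` A); last first.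
    by apply/seteqP; split=> // -[x y] [].
  apply: radon_pushforward => //; first exact: hausdorff_prod.
  exact: fst_continuous.
rewrite (_ : [set: X] `*` B = snd @^-1` B); last first.
  by apply/seteqP; split=> // -[x y] [].
apply: radon_pushforward => //; first exact: hausdorff_prod.
exact: snd_continuous.
Qed.

Lemma plans_integral_fst sigma (a : borel X -> R) : plans mu nu sigma ->
  measurable_fun setT a -> (forall x, 0 <= a x) ->
  (\int[sigma]_(z in [set: borel (X * Y)%type]) (a z.1)%:E =
   \int[mu]_x (a x)%:E)%E.
Proof.
move=> [_ s1 _] ma a0.
have mp := continuous_measurable_borel (@fst_continuous X Y).
rewrite [RHS](eq_measure_integral
    (pushforward sigma (fst : borel (X * Y)%type -> borel X))).
  rewrite ge0_integral_pushforward//; first exact/measurable_EFinP.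
  by move=> x _; rewrite lee_fin.
move=> A mA _; apply: (etrans (esym (s1 A mA))); congr (sigma _).
by apply/seteqP; split=> -[x y] //= [].
Qed.

Lemma plans_integral_snd sigma (b : borel Y -> R) : plans mu nu sigma ->
  measurable_fun setT b -> (forall y, 0 <= b y) ->
  (\int[sigma]_(z in [set: borel (X * Y)%type]) (b z.2)%:E =
   \int[nu]_y (b y)%:E)%E.
Proof.
move=> [_ _ s2] mb b0.
have mp := continuous_measurable_borel (@snd_continuous X Y).
rewrite [RHS](eq_measure_integral
    (pushforward sigma (snd : borel (X * Y)%type -> borel Y))).
  rewrite ge0_integral_pushforward//; first exact/measurable_EFinP.
  by move=> x _; rewrite lee_fin.
move=> A mA _; apply: (etrans (esym (s2 A mA))); congr (sigma _).
by apply/seteqP; split=> -[x y] //= [].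
Qed.

Lemma plans_mean_fst sigma phi : plans mu nu sigma -> bcont phi ->
  mean sigma (phi \o fst) = mean mu phi.
Proof.
move=> ps cphi; have [_ [M phiM]] := cphi.
(* The shift makes the function nonnegative, as the transfer of integrals requires. *)
pose f x := phi x + M.
have cM (Z : ptopologicalType) : bcont (fun _ : Z => M) by exact: bcont_cst.
have cf : bcont f by exact: bcontD.
have f0 x : 0 <= f x by have := phiM x; rewrite ler_norml /f; lra.
have cfst := @fst_continuous X Y.
suff : mean sigma (f \o fst) = mean mu f.
  have -> : mean mu f = mean mu phi + M by rewrite meanD// mean_cst.
  have -> : mean sigma (f \o fst) = mean sigma (phi \o fst) + M.
    rewrite -[X in _ + X](mean_cst sigma) -meanD//; exact: bcont_comp.
  exact: addIr.
apply: EFin_inj; rewrite !meanE//; last exact: bcont_comp.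
by rewrite plans_integral_fst//; exact: continuous_measurable_real cf.1.
Qed.

Lemma plans_mean_snd sigma psi : plans mu nu sigma -> bcont psi ->
  mean sigma (psi \o snd) = mean nu psi.
Proof.
move=> ps cpsi; have [_ [M psiM]] := cpsi.
pose f y := psi y + M.
have cM (Z : ptopologicalType) : bcont (fun _ : Z => M) by exact: bcont_cst.
have cf : bcont f by exact: bcontD.
have f0 y : 0 <= f y by have := psiM y; rewrite ler_norml /f; lra.
have csnd := @snd_continuous X Y.
suff : mean sigma (f \o snd) = mean nu f.
  have -> : mean nu f = mean nu psi + M by rewrite meanD// mean_cst.
  have -> : mean sigma (f \o snd) = mean sigma (psi \o snd) + M.
    rewrite -[X in _ + X](mean_cst sigma) -meanD//; exact: bcont_comp.
  exact: addIr.
apply: EFin_inj; rewrite !meanE//; last exact: bcont_comp.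
by rewrite plans_integral_snd//; exact: continuous_measurable_real cf.1.
Qed.

(** The bound involves the marginals only, so it is uniform over all plans: tight marginals give
    tight plans. *)
Lemma plans_setC_prod sigma (K : set X) (L : set Y) (d : R) :
  plans mu nu sigma -> compact K -> compact L ->
  (mu (~` K) <= d%:E)%E -> (nu (~` L) <= d%:E)%E ->
  (sigma (~` (K `*` L)) <= (2 * d)%:E)%E.
Proof.
move=> [_ s1 s2] cK cL muK nuL.
have mK : measurable (~` K : set (borel X)) by apply: measurableC; exact: compact_borel.
have mL : measurable (~` L : set (borel Y)) by apply: measurableC; exact: compact_borel.
have mfst := continuous_measurable_borel (@fst_continuous X Y).
have msnd := continuous_measurable_borel (@snd_continuous X Y).
rewrite (_ : ~` _ = (~` K `*` [set: Y]) `|` ([set: X] `*` ~` L)); last first.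
  apply/seteqP; split=> -[x y] /=.
    move=> nKL; have [Kx|nKx] := pselect (K x); last by left.
    by right; split=> // Ly; exact: nKL.
  by move=> [[nKx _] []|[_ nLy] []].
apply: (@le_trans _ _ (sigma (~` K `*` [set: Y]) + sigma ([set: X] `*` ~` L))%E).
  apply: measureU2.
    rewrite (_ : _ `*` _ = fst @^-1` (~` K)).
      by rewrite -[X in measurable X]setTI; exact: mfst.
    by apply/seteqP; split=> -[x y] //= [].
  rewrite (_ : _ `*` _ = snd @^-1` (~` L)).
    by rewrite -[X in measurable X]setTI; exact: msnd.
  by apply/seteqP; split=> -[x y] //= [].
by rewrite s1// s2// mulr2n mulrDl mul1r EFinD leeD.
Qed.

End plans_theory.

(** * Radon products and densities *)

Section product_and_density.
Context {R : realType} {X Y : ptopologicalType}.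
Hypotheses (bX : has_bumps R X) (bY : has_bumps R Y).
Hypotheses (hX : hausdorff_space X) (hY : hausdorff_space Y).

Lemma bcont_section (f : X * Y -> R) (x : X) :
  bcont f -> bcont (fun y => f (x, y)).
Proof.
apply: bcont_comp => y; apply: cvg_pair; [exact: cvg_cst|exact: cvg_id].
Qed.

(** Continuity in [x] cannot be tested along sequences, which excludes dominated convergence.
    Instead, a compact [L] carries almost all of [nu], and a tube around [L] makes the sections of
    [f] close to each other on it. *)
Lemma bcont_partial_mean (nu : borel_probability R Y) (f : X * Y -> R) :
  radon nu -> bcont f -> bcont (fun x => mean nu (fun y => f (x, y))).
Proof.
move=> rnu bf; have [cf [M fM]] := bf.
have M0 : 0 <= M by apply: le_trans (fM point).
have sM x x' y : f (x, y) - f (x', y) <= 2 * M.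
  by have := fM (x, y); have := fM (x', y); rewrite !ler_norml; lra.
split; last first.
  by exists M => x; apply: normr_mean_le => //; exact: bcont_section.
move=> x; apply/cvgrPdist_le => e e0.
(* Off [L] two sections differ by at most [2 * M], so mass [e / (4 * (M + 1))] there contributes at
   most [e / 2]. *)
have m0 : 0 < 4 * (M + 1) by rewrite mulr_gt0// ltr_wpDl.
have [L [cL nuL]] := radon_tight rnu (divr_gt0 e0 m0).
have e20 : 0 < e / 2 by rewrite divr_gt0.
have eE : e / 2 + 2 * M * (e / (4 * (M + 1))) <= e.
  rewrite -lerBrDl (_ : e - e / 2 = e / 2); last by lra.
  rewrite mulrA ler_pdivrMr// mulrA.
  by rewrite -subr_ge0 (_ : _ - _ = 2 * e) ?mulr_ge0 ?ltW//; lra.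
have mL := compact_borel hY cL.
have le12 x1 x2 : (forall y, L y -> f (x1, y) <= f (x2, y) + e / 2) ->
    mean nu (fun y => f (x1, y)) <= mean nu (fun y => f (x2, y)) + e.
  move=> f12; apply: le_trans (_ : _ <= mean nu (fun y => f (x2, y)) +
    (e / 2 + 2 * M * (e / (4 * (M + 1))))) _; last by rewrite lerD2l.
  apply: (@mean_compare R Y nu _ _ L) => //; try exact: bcont_section.
  - by move=> y; rewrite -lerBlDl.
  - by rewrite mulr_ge0.
  - exact: ltW.
have [A [W [xA _ LW fAW]]] := compact_tube x cf cL e20.
near=> x'.
have fx' y : L y -> `|f (x, y) - f (x', y)| <= e / 2.
  by move=> /LW; apply: fAW; near: x'.
rewrite ler_distlC; apply/andP; split; rewrite ?lerBlDr; apply: le12 => y /fx';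
  by rewrite ler_norml; lra.
Unshelve. all: by end_near. Qed.

(* The usual product measure is only defined on the product sigma-algebra. *)
Lemma radon_product (mu : borel_probability R X) (nu : borel_probability R Y) :
  radon mu -> radon nu -> exists rho : borel_probability R (X * Y)%type,
    radon rho /\ forall phi psi, bcont phi -> bcont psi ->
      mean rho (fun z => phi z.1 * psi z.2) = mean mu phi * mean nu psi.
Proof.
move=> rmu rnu.
pose L f := mean mu (fun x => mean nu (fun y => f (x, y))).
have LD f g : bcont f -> bcont g -> L (fun z => f z + g z) = L f + L g.
  move=> cf cg; rewrite /L -meanD; [|exact: bcont_partial_mean..].
  congr (mean mu); apply/funext => x.
  by rewrite -meanD//; exact: bcont_section.
have LZ c f : bcont f -> L (fun z => c * f z) = c * L f.
  move=> cf; rewrite /L -meanZ; last exact: bcont_partial_mean.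
  congr (mean mu); apply/funext => x.
  by rewrite -meanZ//; exact: bcont_section.
have L_ge0 f : bcont f -> (forall z, 0 <= f z) -> 0 <= L f.
  by move=> cf f0; apply: mean_ge0 => x; exact: mean_ge0.
have L1 : L (fun=> 1) = 1.
  by rewrite /L -[RHS](mean_cst mu); congr mean; apply/funext => x; exact: mean_cst.
have L_tight e : 0 < e -> exists K : set (X * Y), compact K /\
    forall f, bcont f -> (forall z, 0 <= f z <= 1) ->
      (forall z, K z -> f z = 0) -> L f <= e.
  move=> e0; have e20 : 0 < e / 2 by rewrite divr_gt0.
  have [K [cK muK]] := radon_tight rmu e20.
  have [K' [cK' nuK']] := radon_tight rnu e20.
  exists (K `*` K'); split; first exact: compact_setX.
  move=> f cf f01 fK.
  have b0 (Z : ptopologicalType) : bcont (fun _ : Z => 0 : R) by exact: bcont_cst.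
  have := @mean_compare R X mu _ (fun=> 0) K 1 (e / 2) (e / 2)
    (bcont_partial_mean rnu cf) (b0 _).
  rewrite mean_cst !add0r mul1r -splitr; apply=> //; last 3 first.
  - exact: compact_borel.
  - move=> x Kx.
    have := @mean_compare R Y nu _ (fun=> 0) K' 1 0 (e / 2)
      (bcont_section x cf) (b0 _).
    rewrite mean_cst !add0r mul1r; apply=> //.
    + by move=> y; case/andP: (f01 (x, y)).
    + exact: compact_borel.
    + by move=> y Ky; rewrite fK.
  - exact: ltW.
  move=> x; rewrite -[leRHS](mean_cst nu).
  apply: le_mean; [exact: bcont_section|exact: bcont_cst|move=> y].
  by case/andP: (f01 (x, y)).
have [rho [rrho rhoL]] := riesz_radon (TightFunctional LD LZ L_ge0 L1 L_tight)
  (has_bumps_prod bX bY) (hausdorff_prod hX hY).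
exists rho; split=> // phi psi cphi cpsi.
have cphi1 : bcont (fun z : X * Y => phi z.1).
  by apply: (bcont_comp _ cphi); exact: fst_continuous.
have cpsi2 : bcont (fun z : X * Y => psi z.2).
  by apply: (bcont_comp _ cpsi); exact: snd_continuous.
rewrite rhoL/=; last exact: bcontM.
rewrite /L/= mulrC -meanZ//; congr (mean mu); apply/funext => x.
by rewrite meanZ// mulrC.
Qed.

End product_and_density.

Lemma radon_density (R : realType) (Z : ptopologicalType)
    (rho : borel_probability R Z) (G : Z -> R) :
  has_bumps R Z -> hausdorff_space Z -> radon rho -> bcont G ->
  (forall z, 0 <= G z) -> mean rho G = 1 ->
  exists pi : borel_probability R Z,
    radon pi /\ forall f, bcont f -> mean pi f = mean rho (fun z => f z * G z).
Proof.
move=> bZ hZ rrho cG G0 G1; pose L f := mean rho (fun z => f z * G z).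
have LD f g : bcont f -> bcont g -> L (fun z => f z + g z) = L f + L g.
  move=> cf cg; rewrite /L -meanD; [|exact: bcontM..].
  by congr mean; apply/funext => z; rewrite mulrDl.
have LZ c f : bcont f -> L (fun z => c * f z) = c * L f.
  move=> cf; rewrite /L -meanZ; last exact: bcontM.
  by congr mean; apply/funext => z; rewrite mulrA.
have L_ge0 f : bcont f -> (forall z, 0 <= f z) -> 0 <= L f.
  by move=> cf f0; apply: mean_ge0 => z; rewrite mulr_ge0.
have L1 : L (fun=> 1) = 1.
  by rewrite /L -[RHS]G1; congr mean; apply/funext => z; rewrite mul1r.
have L_tight e : 0 < e -> exists K : set Z, compact K /\
    forall f, bcont f -> (forall z, 0 <= f z <= 1) ->
      (forall z, K z -> f z = 0) -> L f <= e.
  move=> e0; have [_ [M GM]] := cG.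
  have [K [cK rhoK]] := mean_tight hZ rrho M e0.
  exists K; split=> // f cf f01 fK; apply: rhoK; first exact: bcontM.
    move=> z; case/andP: (f01 z) => f0 f1; rewrite mulr_ge0//=.
    rewrite (le_trans _ (GM z))// (le_trans _ (ler_norm _))//.
    by rewrite ler_piMl.
  by move=> z /fK ->; rewrite mul0r.
by have [pi] := riesz_radon (TightFunctional LD LZ L_ge0 L1 L_tight) bZ hZ; exists pi.
Qed.

(** * Couplings close to a given plan *)

Section coupling.
Context {R : realType} {X Y : ptopologicalType}.
Hypotheses (bX : has_bumps R X) (bY : has_bumps R Y).
Hypotheses (hX : hausdorff_space X) (hY : hausdorff_space Y).

Lemma bcont_fst_mul_snd (f : X -> R) (g : Y -> R) : bcont f -> bcont g ->
  bcont (fun z : X * Y => f z.1 * g z.2).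
Proof.
move=> cf cg; apply: bcontM.
  by apply: (bcont_comp _ cf); exact: fst_continuous.
by apply: (bcont_comp _ cg); exact: snd_continuous.
Qed.

(* The density [theta * sum_ij c_ij phi_i psi_j] has marginal densities at most
   1; the defect [u], [v] of its marginals is filled by a product measure. *)
Lemma coupling_of_matrix (mu : borel_probability R X) (nu : borel_probability R Y)
    (I J : eqType) (s : seq I) (t : seq J) (phi : I -> X -> R) (psi : J -> Y -> R)
    (c : I -> J -> R) (theta : R) :
  radon mu -> radon nu ->
  (forall i, bcont (phi i)) -> (forall j, bcont (psi j)) ->
  (forall i x, 0 <= phi i x) -> (forall j y, 0 <= psi j y) ->
  (forall x, \sum_(i <- s) phi i x <= 1) -> (forall y, \sum_(j <- t) psi j y <= 1) ->
  (forall i j, 0 <= c i j) -> 0 <= theta ->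
  (forall i, i \in s -> theta * \sum_(j <- t) c i j * mean nu (psi j) <= 1) ->
  (forall j, j \in t -> theta * \sum_(i <- s) c i j * mean mu (phi i) <= 1) ->
  forall m : R, m = 1 - theta * \sum_(i <- s) \sum_(j <- t)
    c i j * (mean mu (phi i) * mean nu (psi j)) -> 0 < m ->
  exists pi, plans mu nu pi /\
    forall (F : X * Y -> R) (a : I -> J -> R) (M : R), bcont F ->
      (forall i j x y, i \in s -> j \in t ->
        F (x, y) * (phi i x * psi j y) <= a i j * (phi i x * psi j y)) ->
      (forall z, F z <= M) ->
      mean pi F <= theta * \sum_(i <- s) \sum_(j <- t)
        c i j * (a i j * (mean mu (phi i) * mean nu (psi j))) + M * m.
Proof.
move=> rmu rnu cphi cpsi phi0 psi0 phi1 psi1 c0 theta0 rs rt m mE m0.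
pose r i := \sum_(j <- t) c i j * mean nu (psi j).
pose r' j := \sum_(i <- s) c i j * mean mu (phi i).
pose u x := 1 - theta * \sum_(i <- s) r i * phi i x.
pose v y := 1 - theta * \sum_(j <- t) r' j * psi j y.
have [rho [rrho rhoM]] := radon_product bX bY hX hY rmu rnu.
have c1 (Z : ptopologicalType) : bcont (fun _ : Z => 1 : R) by exact: bcont_cst.
have csum_phi : bcont (fun x => \sum_(i <- s) r i * phi i x).
  by apply: bcont_sum => i; exact: bcontZ.
have csum_psi : bcont (fun y => \sum_(j <- t) r' j * psi j y).
  by apply: bcont_sum => j; exact: bcontZ.
have cu : bcont u by apply: bcontB => //; exact: bcontZ.
have cv : bcont v by apply: bcontB => //; exact: bcontZ.
have u0 x : 0 <= u x.
  rewrite subr_ge0 (le_trans _ (phi1 x))// mulr_sumr big_seq [leRHS]big_seq.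
  by apply: ler_sum => i si; rewrite mulrA ler_piMl// rs.
have v0 y : 0 <= v y.
  rewrite subr_ge0 (le_trans _ (psi1 y))// mulr_sumr big_seq [leRHS]big_seq.
  by apply: ler_sum => j tj; rewrite mulrA ler_piMl// rt.
(* Both defects have the same total mass [m], namely the mass missing from the matrix part. Hence
   the product density of [u] and [v] divided by [m] has marginal densities exactly [u] and [v]. *)
pose G z := theta * \sum_(i <- s) \sum_(j <- t) c i j * (phi i z.1 * psi j z.2)
  + m^-1 * (u z.1 * v z.2).
have cG : bcont G.
  apply: bcontD; apply: bcontZ; last exact: bcont_fst_mul_snd.
  apply: bcont_sum => i; apply: bcont_sum => j; apply: bcontZ.
  exact: bcont_fst_mul_snd.
have G0 z : 0 <= G z.
  rewrite addr_ge0// mulr_ge0 ?invr_ge0 ?(ltW m0)// ?mulr_ge0//.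
  by apply: sumr_ge0 => i _; apply: sumr_ge0 => j _; rewrite !mulr_ge0.
(* One formula for products of test functions covers both marginals, on putting one factor equal to
   1. *)
have meanG f g : bcont f -> bcont g ->
    mean rho (fun z => f z.1 * g z.2 * G z) =
    theta * (\sum_(i <- s) \sum_(j <- t) c i j *
      (mean mu (fun x => f x * phi i x) * mean nu (fun y => g y * psi j y))) +
    m^-1 * (mean mu (fun x => f x * u x) * mean nu (fun y => g y * v y)).
  move=> cf cg.
  have cfphi i : bcont (fun x => f x * phi i x) by exact: bcontM.
  have cgpsi j : bcont (fun y => g y * psi j y) by exact: bcontM.
  have cfu : bcont (fun x => f x * u x) by exact: bcontM.
  have cgv : bcont (fun y => g y * v y) by exact: bcontM.
  pose H i j (z : X * Y) := (f z.1 * phi i z.1) * (g z.2 * psi j z.2).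
  have cH i j : bcont (H i j).
    exact: (@bcont_fst_mul_snd (fun x => f x * phi i x) (fun y => g y * psi j y)).
  pose H' (z : X * Y) := (f z.1 * u z.1) * (g z.2 * v z.2).
  have cH' : bcont H'.
    exact: (@bcont_fst_mul_snd (fun x => f x * u x) (fun y => g y * v y)).
  have cHs i : bcont (fun z => \sum_(j <- t) c i j * H i j z).
    by apply: bcont_sum => j; exact: bcontZ.
  have cHss : bcont (fun z => \sum_(i <- s) \sum_(j <- t) c i j * H i j z).
    exact: bcont_sum.
  rewrite (_ : (fun z => _) = fun z => theta *
      (\sum_(i <- s) \sum_(j <- t) c i j * H i j z) + m^-1 * H' z); last first.
    apply/funext => z; rewrite /G mulrDr mulrCA; congr (_ * _ + _).
      rewrite mulr_sumr; apply: eq_bigr => i _; rewrite mulr_sumr.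
      by apply: eq_bigr => j _; rewrite /H; ring.
    by rewrite /H'; ring.
  rewrite meanD; [|exact: bcontZ..]; rewrite !meanZ// mean_sum//.
  congr (_ * _ + _ * _); last exact: (rhoM (fun x => f x * u x) (fun y => g y * v y)).
  apply: eq_bigr => i _; rewrite mean_sum; last by move=> j; exact: bcontZ.
  apply: eq_bigr => j _; rewrite meanZ//; congr (_ * _).
  exact: (rhoM (fun x => f x * phi i x) (fun y => g y * psi j y)).
have mean_u f : bcont f -> mean mu (fun x => f x * u x) =
    mean mu f - theta * \sum_(i <- s) r i * mean mu (fun x => f x * phi i x).
  move=> cf; have cfphi i : bcont (fun x => f x * phi i x) by exact: bcontM.
  have cs : bcont (fun x => \sum_(i <- s) r i * (f x * phi i x)).
    by apply: bcont_sum => i; exact: bcontZ.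
  rewrite (_ : (fun x => _) = fun x => f x -
      theta * \sum_(i <- s) r i * (f x * phi i x)); last first.
    apply/funext => x; rewrite /u mulrBr mulr1; congr (_ - _).
    rewrite (mulrCA (f x)); congr (_ * _).
    by rewrite mulr_sumr; apply: eq_bigr => i _; rewrite mulrCA.
  rewrite meanB//; last exact: bcontZ.
  rewrite meanZ// mean_sum; last by move=> i; exact: bcontZ.
  by congr (_ - _ * _); apply: eq_bigr => i _; rewrite meanZ.
have mean_v g : bcont g -> mean nu (fun y => g y * v y) =
    mean nu g - theta * \sum_(j <- t) r' j * mean nu (fun y => g y * psi j y).
  move=> cg; have cgpsi j : bcont (fun y => g y * psi j y) by exact: bcontM.
  have cs : bcont (fun y => \sum_(j <- t) r' j * (g y * psi j y)).
    by apply: bcont_sum => j; exact: bcontZ.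
  rewrite (_ : (fun y => _) = fun y => g y -
      theta * \sum_(j <- t) r' j * (g y * psi j y)); last first.
    apply/funext => y; rewrite /v mulrBr mulr1; congr (_ - _).
    rewrite (mulrCA (g y)); congr (_ * _).
    by rewrite mulr_sumr; apply: eq_bigr => j _; rewrite mulrCA.
  rewrite meanB//; last exact: bcontZ.
  rewrite meanZ// mean_sum; last by move=> j; exact: bcontZ.
  by congr (_ - _ * _); apply: eq_bigr => j _; rewrite meanZ.
have one_mul (Z : ptopologicalType) (P : borel_probability R Z) (f : Z -> R) :
    mean P (fun z => 1 * f z) = mean P f.
  by congr mean; apply/funext => z; rewrite mul1r.
have mean_u1 : mean mu u = m.
  rewrite -one_mul mean_u// mean_cst mE; congr (_ - _ * _).
  apply: eq_bigr => i _; rewrite one_mul /r mulr_suml.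
  by apply: eq_bigr => j _; ring.
have mean_v1 : mean nu v = m.
  rewrite -one_mul mean_v// mean_cst mE exchange_big/=; congr (_ - _ * _).
  apply: eq_bigr => j _; rewrite one_mul /r' mulr_suml.
  by apply: eq_bigr => i _; ring.
have marg1 f : bcont f -> mean rho (fun z => f z.1 * G z) = mean mu f.
  move=> cf.
  transitivity (mean rho (fun z => f z.1 * 1 * G z)).
    by congr mean; apply/funext => z; rewrite mulr1.
  rewrite (meanG f (fun=> 1))// one_mul mean_v1 mulrCA mulVf ?gt_eqF// mulr1 mean_u//.
  rewrite [X in theta * X](_ : _ =
    \sum_(i <- s) r i * mean mu (fun x => f x * phi i x)); first by ring.
  apply: eq_bigr => i _; rewrite /r mulr_suml; apply: eq_bigr => j _.
  by rewrite one_mul; ring.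
have marg2 g : bcont g -> mean rho (fun z => g z.2 * G z) = mean nu g.
  move=> cg.
  transitivity (mean rho (fun z => 1 * g z.2 * G z)).
    by congr mean; apply/funext => z; rewrite mul1r.
  rewrite (meanG (fun=> 1) g)// one_mul mean_u1 mulKf ?gt_eqF// mean_v//.
  rewrite exchange_big/= [X in theta * X](_ : _ =
    \sum_(j <- t) r' j * mean nu (fun y => g y * psi j y)); first by ring.
  apply: eq_bigr => j _; rewrite /r' mulr_suml; apply: eq_bigr => i _.
  by rewrite one_mul; ring.
have G1 : mean rho G = 1 by rewrite -one_mul (marg1 (fun=> 1))// mean_cst.
have [pi [rpi piG]] := radon_density (has_bumps_prod bX bY) (hausdorff_prod hX hY)
  rrho cG G0 G1.
exists pi; split.
  apply: plans_mean => // [f cf|g cg].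
    by rewrite piG ?marg1//; apply: (bcont_comp _ cf); exact: fst_continuous.
  by rewrite piG ?marg2//; apply: (bcont_comp _ cg); exact: snd_continuous.
move=> F a M cF Fa FM; rewrite piG//.
have crow i : bcont (fun z : X * Y =>
    \sum_(j <- t) c i j * (a i j * (phi i z.1 * psi j z.2))).
  by apply: bcont_sum => j; do 2!apply: bcontZ; exact: bcont_fst_mul_snd.
have crows : bcont (fun z : X * Y =>
    \sum_(i <- s) \sum_(j <- t) c i j * (a i j * (phi i z.1 * psi j z.2))).
  exact: bcont_sum.
have cuv : bcont (fun z : X * Y => u z.1 * v z.2) by exact: bcont_fst_mul_snd.
(* On each box of the matrix part [F] is replaced by the bound [a i j], and on the filling part, of
   mass [m], by [M]. *)
apply: (@le_trans _ _ (mean rho (fun z =>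
    theta * (\sum_(i <- s) \sum_(j <- t) c i j * (a i j * (phi i z.1 * psi j z.2)))
    + (M * m^-1) * (u z.1 * v z.2)))).
  apply: le_mean; first exact: bcontM.
    by apply: bcontD; exact: bcontZ.
  move=> [x y]; rewrite /G mulrDr; apply: lerD.
    rewrite mulrCA ler_wpM2l// mulr_sumr big_seq [leRHS]big_seq.
    apply: ler_sum => i si; rewrite mulr_sumr big_seq [leRHS]big_seq.
    by apply: ler_sum => j tj; rewrite mulrCA ler_wpM2l// Fa.
  by rewrite -mulrA ler_wpM2r// ?mulr_ge0// invr_ge0 ltW.
rewrite meanD; [|exact: bcontZ..]; rewrite !meanZ// mean_sum// rhoM//.
rewrite mean_u1 mean_v1 lerD//; last by rewrite -mulrA mulKf ?gt_eqF.
rewrite ler_wpM2l//; apply: ler_sum => i _; rewrite mean_sum; last first.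
  by move=> j; do 2!apply: bcontZ; exact: bcont_fst_mul_snd.
apply: ler_sum => j _; rewrite meanZ; last by apply: bcontZ; exact: bcont_fst_mul_snd.
by rewrite meanZ ?rhoM//; exact: bcont_fst_mul_snd.
Qed.

End coupling.

Section approximating_plans.
Context {R : realType} {X Y : ptopologicalType}.
Hypotheses (bX : has_bumps R X) (bY : has_bumps R Y).
Hypotheses (hX : hausdorff_space X) (hY : hausdorff_space Y).

(** A grid of boxes on which [F] oscillates little, obtained in two stages. The [phi i] make [F]
    vary little in [x], uniformly over a neighbourhood of [L]. Once [s] is finite, the [psi j] can
    be confined to all these neighbourhoods at once and to sets where [F] varies little in [y],
    uniformly over [K]. The route from [(x, y)] to [(i, j)] goes through [(i, y)], with [i] in
    [K]. *)
Lemma product_bumps (F : X * Y -> R) (K : set X) (L : set Y) (e : R) :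
  continuous F -> compact K -> compact L -> 0 < e ->
  exists (s : seq X) (t : seq Y) (phi : X -> X -> R) (psi : Y -> Y -> R),
    [/\ forall i, bcont (phi i), forall i x, 0 <= phi i x,
      (forall x, \sum_(i <- s) phi i x <= 1) /\
      (forall x, K x -> \sum_(i <- s) phi i x = 1) &
    [/\ forall j, bcont (psi j), forall j y, 0 <= psi j y,
      (forall y, \sum_(j <- t) psi j y <= 1) /\
      (forall y, L y -> \sum_(j <- t) psi j y = 1) &
      forall i j x y, i \in s -> j \in t ->
        `|F (x, y) - F (i, j)| * (phi i x * psi j y) <= e * (phi i x * psi j y)]].
Proof.
move=> cF cK cL e0; have e20 : 0 < e / 2 by rewrite divr_gt0.
have /choice[AW AWP] : forall x, exists AW : set X * set Y,
    [/\ nbhs x AW.1, open AW.2, L `<=` AW.2 &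
      forall x' y, AW.1 x' -> AW.2 y -> `|F (x, y) - F (x', y)| <= e / 2].
  by move=> x; have [A [W ?]] := compact_tube x cF cL e20; exists (A, W).
have [|s [phi [sK cphi phi0 phiN phi1]]] :=
  subordinate_bumps (K := K) (N := fun x => (AW x).1) bX cK.
  by move=> x _; have [] := AWP x.
have cFs : continuous (fun z : Y * X => F (z.2, z.1)).
  move=> z; apply: (@continuous_comp _ _ _ (fun z => (z.2, z.1)) F); last exact: cF.
  by apply: cvg_pair; [exact: snd_continuous|exact: fst_continuous].
have /choice[N NP] : forall y, exists N, nbhs y N /\
    forall y', N y' -> forall x, K x -> `|F (x, y) - F (x, y')| <= e / 2.
  move=> y; have [A [W [yA _ KW AWe]]] := compact_tube y cFs cK e20.
  by exists A; split=> // y' Ay' x Kx; apply: (AWe y' x) => //; exact: KW.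
have [|t [psi [tL cpsi psi0 psiN psi1]]] :=
  subordinate_bumps (K := L)
    (N := fun y => N y `&` \big[setI/setT]_(i <- s) (AW i).2) bY cL.
  move=> y Ly; apply: filterI; first by have [] := NP y.
  rewrite big_seq; elim/big_ind : _ => [|*|i si]; first exact: filterT.
    exact: filterI.
  by have [_ oW LW _] := AWP i; apply: open_nbhs_nbhs; split=> //; exact: LW.
exists s, t, phi, psi; split=> //; split=> // i j x y si tj.
have [Ax|/phiN ->] := pselect ((AW i).1 x); last by rewrite mul0r !mulr0.
have [[Ny Wy]|/psiN ->] :=
  pselect ((N j `&` \big[setI/setT]_(i <- s) (AW i).2) y); last by rewrite !mulr0.
rewrite ler_wpM2r ?mulr_ge0//.
have Wiy : (AW i).2 y.
  by move: Wy; rewrite -bigcap_seq; apply.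
have [_ _ _ /(_ x y Ax Wiy) h1] := AWP i.
have [_ /(_ y Ny i (sK _ si)) h2] := NP j.
by move: h1 h2; rewrite !ler_norml; lra.
Qed.

Lemma cvg_sum_seq (I : Type) (s : seq I) (f : I -> nat -> R) (l : I -> R) :
  (forall i, f i n @[n --> \oo] --> l i) ->
  (\sum_(i <- s) f i n) @[n --> \oo] --> \sum_(i <- s) l i.
Proof.
move=> fl; elim: s => [|i s IH].
  by under eq_fun do rewrite big_nil; rewrite big_nil; exact: cvg_cst.
by under eq_fun do rewrite big_cons; rewrite big_cons; apply: cvgD.
Qed.

Lemma near_seq (I : eqType) (s : seq I) (P : I -> nat -> Prop) :
  (forall i, \forall n \near \oo, P i n) ->
  \forall n \near \oo, forall i, i \in s -> P i n.
Proof.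
move=> nP; elim: s => [|i s IH]; first by near=> n.
near=> n => j; rewrite inE => /predU1P[->|].
  by near: n; exact: nP.
by move: j; near: n.
Unshelve. all: by end_near. Qed.

Lemma weakly_converges_mean (Z : ptopologicalType)
    (mu_ : nat -> borel_probability R Z) (mu : borel_probability R Z) f :
  weakly_converges mu_ mu -> bcont f -> mean (mu_ n) f @[n --> \oo] --> mean mu f.
Proof.
move=> cmu cf; have [c1 b1] := (bcont_bounded_fun f).1 cf.
have := cmu f c1 b1; rewrite -meanE//.
by move/fine_cvgP => [_].
Qed.

(** The averaged [sigma] has density [\sum_ij c_ij phi_i psi_j] with respect to the product of [mu]
    and [nu]. The coefficients are kept while [mu] and [nu] are replaced by [mu_ n] and [nu_ n];
    mass, marginal bounds and cost then depend on finitely many means of bumps, all of which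
    converge. *)
Lemma approximating_plans (mu_ : nat -> borel_probability R X)
    (mu : borel_probability R X) (nu_ : nat -> borel_probability R Y)
    (nu : borel_probability R Y) (sigma : borel_probability R (X * Y)%type)
    (F : X * Y -> R) (e : R) :
  (forall n, radon (mu_ n)) -> radon mu -> (forall n, radon (nu_ n)) -> radon nu ->
  weakly_converges mu_ mu -> weakly_converges nu_ nu -> plans mu nu sigma ->
  bcont F -> (forall z, 0 <= F z) -> 0 < e ->
  \forall n \near \oo, exists pi, plans (mu_ n) (nu_ n) pi /\
    mean pi F <= mean sigma F + e.
Proof.
move=> rmu_ rmu rnu_ rnu cmu cnu psigma cF F0 e0.
have [_ [M FM]] := cF.
have M0 : 0 <= M by exact: le_trans (FM point).
(* The cost error is at most [2 * d] from oscillation and [M * (3 * d)] from the refilled mass; one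
   more [d] makes the inequality strict, so that it persists for large [n]. The bound 1/2 keeps
   [theta] positive. *)
pose d := Num.min (e / (3 * M + 3)) 2^-1.
have M30 : 0 < 3 * M + 3 by lra.
have d0 : 0 < d by rewrite lt_min invr_gt0 ltr0n andbT divr_gt0.
have d2 : d <= 2^-1 by rewrite ge_min lexx orbT.
have de : d * (3 * M + 3) <= e by rewrite -ler_pdivlMr// ge_min lexx.
have [K [cK muK]] := radon_tight rmu d0.
have [L [cL nuL]] := radon_tight rnu d0.
have [s [t [phi [psi [cphi phi0 [phi1 phiK] [cpsi psi0 [psi1 psiL] osc]]]]]] :=
  product_bumps cF.1 cK cL d0.
pose p i := mean mu (phi i); pose q j := mean nu (psi j).
pose w i j := mean sigma (fun z => phi i z.1 * psi j z.2).
(* If [p i] or [q j] vanishes, division gives 0, which is the right value: the box mass [w i j] is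
   at most either of them. *)
pose c i j := w i j / (p i * q j).
have cphi1 i : bcont (fun z : X * Y => phi i z.1).
  by apply: (bcont_comp _ (cphi i)); exact: fst_continuous.
have cpsi2 j : bcont (fun z : X * Y => psi j z.2).
  by apply: (bcont_comp _ (cpsi j)); exact: snd_continuous.
have cw i j : bcont (fun z : X * Y => phi i z.1 * psi j z.2) by exact: bcontM.
have p0 i : 0 <= p i by exact: mean_ge0.
have q0 j : 0 <= q j by exact: mean_ge0.
have w0 i j : 0 <= w i j by apply: mean_ge0 => z; rewrite mulr_ge0.
have c0 i j : 0 <= c i j by rewrite divr_ge0// mulr_ge0.
have pE i : p i = mean sigma (fun z => phi i z.1).
  exact: esym (plans_mean_fst psigma (cphi i)).
have qE j : q j = mean sigma (fun z => psi j z.2).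
  exact: esym (plans_mean_snd psigma (cpsi j)).
have sum_wp i : \sum_(j <- t) w i j <= p i.
  rewrite -mean_sum// pE; apply: le_mean => // [|z]; first exact: bcont_sum.
  by rewrite -mulr_sumr ler_piMr.
have sum_wq j : \sum_(i <- s) w i j <= q j.
  rewrite -mean_sum// qE; apply: le_mean => // [|z]; first exact: bcont_sum.
  by rewrite -mulr_suml ler_piMl.
have wE i j : i \in s -> j \in t -> c i j * (p i * q j) = w i j.
  move=> si tj; rewrite /c; have [pq0|pq0] := eqVneq (p i * q j) 0; last first.
    by rewrite divfK.
  rewrite pq0 mulr0; apply/esym/eqP; rewrite eq_le w0 andbT.
  move/eqP: pq0; rewrite mulf_eq0 => /orP[/eqP <-|/eqP <-].
    apply: le_trans (sum_wp i); rewrite (big_rem j)//= lerDl.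
    exact: sumr_ge0.
  apply: le_trans (sum_wq j); rewrite (big_rem i)//= lerDl.
  exact: sumr_ge0.
have sum_cq i : \sum_(j <- t) c i j * q j <= 1.
  have [pi0|pi0] := eqVneq (p i) 0.
    by rewrite big1// => j _; rewrite /c pi0 mul0r invr0 mulr0 mul0r.
  have pi0' : 0 < p i by rewrite lt_neqAle eq_sym pi0 p0.
  rewrite -(ler_pM2l pi0') mulr1 (le_trans _ (sum_wp i))// mulr_sumr.
  apply: ler_sum => j _; rewrite /c.
  have [->|qj0] := eqVneq (q j) 0; first by rewrite !mulr0.
  by rewrite [leLHS](_ : _ = w i j)//; field; apply/andP.
have sum_cp j : \sum_(i <- s) c i j * p i <= 1.
  have [qj0|qj0] := eqVneq (q j) 0.
    by rewrite big1// => i _; rewrite /c qj0 mulr0 invr0 mulr0 mul0r.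
  have qj0' : 0 < q j by rewrite lt_neqAle eq_sym qj0 q0.
  rewrite -(ler_pM2l qj0') mulr1 (le_trans _ (sum_wq j))// mulr_sumr.
  apply: ler_sum => i _; rewrite /c.
  have [->|pi0] := eqVneq (p i) 0; first by rewrite !mulr0.
  by rewrite [leLHS](_ : _ = w i j)//; field; apply/andP.
pose W z := \sum_(i <- s) \sum_(j <- t) phi i z.1 * psi j z.2.
have cW : bcont W by apply: bcont_sum => i; exact: bcont_sum.
have WE z : W z = (\sum_(i <- s) phi i z.1) * (\sum_(j <- t) psi j z.2).
  by rewrite /W mulr_suml; apply: eq_bigr => i _; rewrite mulr_sumr.
have c1 : bcont (fun _ : X * Y => 1 : R) by exact: bcont_cst.
pose T := \sum_(i <- s) \sum_(j <- t) w i j.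
have TE : T = mean sigma W.
  rewrite /W mean_sum; last by move=> i; exact: bcont_sum.
  by apply: eq_bigr => i _; rewrite mean_sum.
have sum_phi0 x : 0 <= \sum_(i <- s) phi i x by exact: sumr_ge0.
have sum_psi0 y : 0 <= \sum_(j <- t) psi j y by exact: sumr_ge0.
have T1 : T <= 1.
  rewrite TE -[leRHS](mean_cst sigma); apply: le_mean => // z.
  by rewrite WE mulr_ile1.
have Td : 1 <= T + 2 * d.
  have := @mean_compare R _ sigma (fun=> 1) W (K `*` L) 1 0 (2 * d) c1 cW.
  rewrite mean_cst -TE add0r mul1r; apply=> //.
  - by move=> z; rewrite lerDr WE mulr_ge0.
  - by apply: compact_borel; [exact: hausdorff_prod|exact: compact_setX].
  - by move=> z [Kz Lz]; rewrite WE phiK// psiL// mulr1 addr0.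
  - exact: plans_setC_prod psigma cK cL muK nuL.
(* The marginal bounds hold for [mu] and [nu] possibly with equality. Shrinking by [theta] makes
   them strict, hence stable along the sequence, and leaves a positive mass to refill. *)
pose theta := 1 - d.
have theta0 : 0 < theta by rewrite /theta; lra.
have theta1 : theta < 1 by rewrite /theta; lra.
have cvg_p i : mean (mu_ n) (phi i) @[n --> \oo] --> p i.
  exact: weakly_converges_mean.
have cvg_q j : mean (nu_ n) (psi j) @[n --> \oo] --> q j.
  exact: weakly_converges_mean.
pose a i j := F (i, j) + d.
pose t_ n := \sum_(i <- s) \sum_(j <- t)
  c i j * (mean (mu_ n) (phi i) * mean (nu_ n) (psi j)).
pose A_ n := \sum_(i <- s) \sum_(j <- t)
  c i j * (a i j * (mean (mu_ n) (phi i) * mean (nu_ n) (psi j))).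
have cvg_t : t_ n @[n --> \oo] --> T.
  rewrite (_ : T = \sum_(i <- s) \sum_(j <- t) c i j * (p i * q j)).
    apply: cvg_sum_seq => i; apply: cvg_sum_seq => j.
    by apply: cvgMr; exact: cvgM.
  rewrite /T big_seq [RHS]big_seq; apply: eq_bigr => i si.
  by rewrite big_seq [RHS]big_seq; apply: eq_bigr => j tj; rewrite wE.
pose A := \sum_(i <- s) \sum_(j <- t) a i j * w i j.
have cvg_A : A_ n @[n --> \oo] --> A.
  rewrite (_ : A = \sum_(i <- s) \sum_(j <- t) c i j * (a i j * (p i * q j))).
    apply: cvg_sum_seq => i; apply: cvg_sum_seq => j.
    by do 2!apply: cvgMr; exact: cvgM.
  rewrite /A big_seq [RHS]big_seq; apply: eq_bigr => i si.
  rewrite big_seq [RHS]big_seq; apply: eq_bigr => j tj.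
  by rewrite -wE// mulrCA.
have A0 : 0 <= A.
  apply: sumr_ge0 => i _; apply: sumr_ge0 => j _.
  by rewrite mulr_ge0// addr_ge0// ltW.
(* One [d] is the margin built into [a i j], the other the oscillation of [F] below [F (i, j)] on
   the box. *)
have sigmaF : A <= mean sigma F + 2 * d.
  have : A - 2 * d * T <= mean sigma F.
    have caw i j : bcont (fun z : X * Y => (F (i, j) - d) * (phi i z.1 * psi j z.2)).
      exact: bcontZ.
    have -> : A - 2 * d * T = mean sigma (fun z =>
        \sum_(i <- s) \sum_(j <- t) (F (i, j) - d) * (phi i z.1 * psi j z.2)).
      rewrite mean_sum; last by move=> i; exact: bcont_sum.
      rewrite /A /T mulr_sumr -sumrB; apply: eq_bigr => i _.
      rewrite mean_sum// mulr_sumr -sumrB; apply: eq_bigr => j _.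
      by rewrite meanZ// -/(w i j) /a; ring.
    apply: le_mean => //; first by apply: bcont_sum => i; exact: bcont_sum.
    move=> [x y]; rewrite (@le_trans _ _ (F (x, y) * W (x, y)))//; last first.
      by rewrite WE ler_piMr// mulr_ile1.
    rewrite /W mulr_sumr big_seq [leRHS]big_seq; apply: ler_sum => i si.
    rewrite mulr_sumr big_seq [leRHS]big_seq; apply: ler_sum => j tj /=.
    have h : (F (i, j) - F (x, y)) * (phi i x * psi j y) <=
        `|F (x, y) - F (i, j)| * (phi i x * psi j y).
      by rewrite ler_wpM2r ?mulr_ge0// distrC ler_norm.
    by have := osc i j x y si tj; move: h; rewrite !mulrBl; lra.
  have : 2 * d * T <= 2 * d by rewrite ler_piMr// mulr_ge0// ltW.
  lra.
have dT : d * T <= d by rewrite ler_piMr// ltW.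
have mT : 1 - theta * T <= 3 * d.
  by rewrite /theta mulrBl mul1r; lra.
have mT0 : 0 < 1 - theta * T.
  by rewrite subr_gt0 (le_lt_trans _ theta1)// ler_piMr// ltW.
have cvg_m : 1 - theta * t_ n @[n --> \oo] --> 1 - theta * T.
  by apply: cvgB; [exact: cvg_cst|exact: cvgMr].
have cvg_B : theta * A_ n + M * (1 - theta * t_ n) @[n --> \oo] -->
    theta * A + M * (1 - theta * T).
  by apply: cvgD; exact: cvgMr.
have Blt : theta * A + M * (1 - theta * T) < mean sigma F + e.
  have : theta * A <= A by rewrite ler_piMl// ltW.
  have : M * (1 - theta * T) <= M * (3 * d) by rewrite ler_wpM2l.
  have : d * (3 * M + 3) = M * (3 * d) + 3 * d by ring.
  lra.
near=> n.
have [|||pi [ppi piF]] := coupling_of_matrix bX bY hX hY (rmu_ n) (rnu_ n)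
    cphi cpsi phi0 psi0 phi1 psi1 c0 (ltW theta0) _ _ (erefl (1 - theta * t_ n)).
- near: n; apply: near_seq => i.
  have cr : theta * \sum_(j <- t) c i j * mean (nu_ n) (psi j) @[n --> \oo] -->
      theta * \sum_(j <- t) c i j * q j.
    by apply: cvgMr; apply: cvg_sum_seq => j; exact: cvgMr.
  have : theta * \sum_(j <- t) c i j * q j < 1.
    by apply: le_lt_trans theta1; rewrite ler_piMr// ltW.
  by move=> /(cvgr_lt _ cr); apply: filterS => n; exact: ltW.
- near: n; apply: near_seq => j.
  have cr : theta * \sum_(i <- s) c i j * mean (mu_ n) (phi i) @[n --> \oo] -->
      theta * \sum_(i <- s) c i j * p i.
    by apply: cvgMr; apply: cvg_sum_seq => i; exact: cvgMr.
  have : theta * \sum_(i <- s) c i j * p i < 1.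
    by apply: le_lt_trans theta1; rewrite ler_piMr// ltW.
  by move=> /(cvgr_lt _ cr); apply: filterS => n; exact: ltW.
- by near: n; exact: (cvgr_gt _ cvg_m).
exists pi; split=> //; apply: le_trans (piF F a M cF _ _) _.
- move=> i j x y si tj.
  have h : (F (x, y) - F (i, j)) * (phi i x * psi j y) <=
      `|F (x, y) - F (i, j)| * (phi i x * psi j y).
    by rewrite ler_wpM2r ?mulr_ge0// ler_norm.
  by have := osc i j x y si tj; move: h; rewrite /a mulrBl mulrDl; lra.
- by move=> z; exact: le_trans (ler_norm _) (FM z).
by apply: ltW; near: n; exact: (cvgr_lt _ cvg_B).
Unshelve. all: by end_near. Qed.

End approximating_plans.

(** * Ultrafilter limits of tight families *)

(** Compactness of the segment gives a cluster point, and a cluster point of an ultrafilter is a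
    limit. *)
Lemma ultra_bounded_cvg (R : realType) (T : Type) (U : set_system T)
    (g : T -> R) (M : R) :
  UltraFilter U -> (forall n, `|g n| <= M) -> cvg (g n @[n --> U]).
Proof.
move=> UU gM; have PU : ProperFilter U by exact: ultra_proper.
have [|p [_ Up]] := @segment_compact R (- M) M (g @ U) _.
  by apply: (@filterE _ U) => n; rewrite /= in_itv/= -ler_norml; exact: gM.
apply/cvg_ex; exists p => N pN.
have [//|UN] := in_ultra_setVsetC (g @^-1` N) UU.
by have [y [nNy Ny]] := Up (~` N) N UN pN.
Qed.

(* Prokhorov's theorem, with ultrafilter limits in place of subsequences, which
   need not converge as the space need not be metrizable. *)
Lemma ultra_prokhorov (R : realType) (Z : ptopologicalType) (T : Type)
    (sigma_ : T -> borel_probability R Z) (U : set_system T) :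
  has_bumps R Z -> hausdorff_space Z -> UltraFilter U ->
  (forall e, 0 < e -> exists K : set Z,
    compact K /\ forall n, (sigma_ n (~` K) <= e%:E)%E) ->
  exists sigma : borel_probability R Z, radon sigma /\
    forall f, bcont f -> mean (sigma_ n) f @[n --> U] --> mean sigma f.
Proof.
move=> bZ hZ UU tight; have PU : ProperFilter U by exact: ultra_proper.
have bc (c : R) : bcont (fun _ : Z => c) by exact: bcont_cst.
pose L f := lim (mean (sigma_ n) f @[n --> U]).
have Lcvg f : bcont f -> mean (sigma_ n) f @[n --> U] --> L f.
  move=> cf; have [_ [M fM]] := cf.
  by apply: (@ultra_bounded_cvg _ _ _ _ M) => // n; exact: normr_mean_le.
have LE f l : mean (sigma_ n) f @[n --> U] --> l -> L f = l.
  exact: (cvg_lim (@Rhausdorff R)).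
have LD f g : bcont f -> bcont g -> L (fun z => f z + g z) = L f + L g.
  move=> cf cg; apply: LE; under eq_fun do rewrite meanD//.
  by apply: cvgD; exact: Lcvg.
have LZ c f : bcont f -> L (fun z => c * f z) = c * L f.
  move=> cf; apply: LE; under eq_fun do rewrite meanZ//.
  by apply: cvgMr; exact: Lcvg.
have L_ge0 f : bcont f -> (forall z, 0 <= f z) -> 0 <= L f.
  move=> cf f0; apply: limr_ge; first by apply/cvg_ex; exists (L f); exact: Lcvg.
  by apply: nearW => n; exact: mean_ge0.
have L1 : L (fun=> 1) = 1.
  by apply: LE; under eq_fun do rewrite mean_cst; exact: cvg_cst.
have L_tight e : 0 < e -> exists K : set Z, compact K /\
    forall f, bcont f -> (forall z, 0 <= f z <= 1) ->
      (forall z, K z -> f z = 0) -> L f <= e.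
  move=> e0; have [K [cK sK]] := tight _ e0; exists K; split=> // f cf f01 fK.
  apply: limr_le; first by apply/cvg_ex; exists (L f); exact: Lcvg.
  apply: nearW => n.
  have := @mean_compare R Z (sigma_ n) f (fun=> 0) K 1 0 e cf (bc 0).
  rewrite mean_cst !add0r mul1r; apply=> //.
  - by move=> z; case/andP: (f01 z).
  - exact: compact_borel.
  - by move=> z /fK ->.
have [sigma [rsigma sigmaL]] :=
  riesz_radon (TightFunctional LD LZ L_ge0 L1 L_tight) bZ hZ.
by exists sigma; split=> // f cf; rewrite sigmaL//; exact: Lcvg.
Qed.

(** * Convergence of costs *)

Lemma family_cvg_near (R : realType) (Z : ptopologicalType)
    (h_ : nat -> Z -> R) (h : Z -> R) (K : set Z) (e : R) :
  {family compact, h_ @ \oo --> h} -> compact K -> 0 < e ->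
  \forall n \near \oo, forall z, K z -> `|h z - h_ n z| <= e.
Proof.
move=> /fam_cvgP /(_ K) + cK e0 => /(_ cK) hK.
have : nbhs (h : {uniform` K -> R}) [set g | forall z, K z -> `|h z - g z| <= e].
  apply/uniform_nbhs; exists [set xy | ball xy.1 e xy.2]; split.
    exact: entourage_ball (PosNum e0).
  by move=> g /= hg z Kz; have := hg z Kz; rewrite /ball/= => /ltW.
by move/hK.
Qed.

Section cost_estimates.
Context {R : realType} {X Y : ptopologicalType}.
Variables (mu : borel_probability R X) (nu : borel_probability R Y).

(** Pointwise, [a - r] is at most [a] restricted to [a >= r], and likewise for [b]. So the excess of
    [h <= a + b] over [r + r] is at most the sum of the two tails, whose integrals under any plan
    depend on the marginals only. *)
Lemma cost_truncation (pi : borel_probability R (X * Y)%type)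
    (h : X * Y -> R) (a : borel X -> R) (b : borel Y -> R) (r : R) :
  plans mu nu pi -> continuous h -> (forall z, 0 <= h z) ->
  (forall x, 0 <= a x) -> (forall y, 0 <= b y) ->
  measurable_fun setT a -> measurable_fun setT b ->
  (forall x y, h (x, y) <= a x + b y) -> 0 <= r ->
  (\int[pi]_(z in [set: borel (X * Y)%type]) (h z)%:E <=
   \int[pi]_(z in [set: borel (X * Y)%type]) (Num.min (h z) (r + r)%R)%:E +
   (\int[mu]_(x in [set x | (r <= a x)%R]) (a x)%:E +
    \int[nu]_(y in [set y | (r <= b y)%R]) (b y)%:E))%E.
Proof.
move=> ppi ch h0 a0 b0 ma mb hab r0.
pose A := [set x | r <= a x]; pose B := [set y | r <= b y].
have mA : measurable (A : set (borel X)).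
  rewrite (_ : A = setT `&` a @^-1` `[r, +oo[).
    exact: (ma measurableT).
  by apply/seteqP; split=> x; rewrite /A /= in_itv/= andbT => // -[].
have mB : measurable (B : set (borel Y)).
  rewrite (_ : B = setT `&` b @^-1` `[r, +oo[).
    exact: (mb measurableT).
  by apply/seteqP; split=> y; rewrite /B /= in_itv/= andbT => // -[].
pose a' := a \_ A; pose b' := b \_ B.
have ma' : measurable_fun setT a'.
  by apply/(measurable_restrictT _ mA); exact: measurable_funS ma.
have mb' : measurable_fun setT b'.
  by apply/(measurable_restrictT _ mB); exact: measurable_funS mb.
have a'0 x : 0 <= a' x by rewrite /a' patchE; case: ifP.
have b'0 y : 0 <= b' y by rewrite /b' patchE; case: ifP.
have aa' x : a x - r <= a' x.
  rewrite /a' patchE; case: ifPn => [_|]; first by rewrite gerBl.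
  by rewrite notin_setE /A /= => /negP; rewrite -ltNge subr_le0 => /ltW.
have bb' y : b y - r <= b' y.
  rewrite /b' patchE; case: ifPn => [_|]; first by rewrite gerBl.
  by rewrite notin_setE /B /= => /negP; rewrite -ltNge subr_le0 => /ltW.
have mfst := continuous_measurable_borel (@fst_continuous X Y).
have msnd := continuous_measurable_borel (@snd_continuous X Y).
have mh := continuous_measurable_real ch.
have cmin : bcont (fun z => Num.min (h z) (r + r)) by exact: bcont_min_cst.
have mmin := continuous_measurable_real cmin.1.
have min0 z : 0 <= Num.min (h z) (r + r) by rewrite le_min h0 addr_ge0.
have ma1 : measurable_fun [set: borel (X * Y)%type] (fun z => (a' z.1)%:E).
  by apply/measurable_EFinP; exact: (measurableT_comp ma' mfst).
have mb2 : measurable_fun [set: borel (X * Y)%type] (fun z => (b' z.2)%:E).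
  by apply/measurable_EFinP; exact: (measurableT_comp mb' msnd).
have -> : (\int[mu]_(x in A) (a x)%:E =
    \int[pi]_(z in [set: borel (X * Y)%type]) (a' z.1)%:E)%E.
  rewrite (plans_integral_fst ppi ma' a'0) integral_mkcond.
  by apply: eq_integral => x _; rewrite restrict_EFin.
have -> : (\int[nu]_(y in B) (b y)%:E =
    \int[pi]_(z in [set: borel (X * Y)%type]) (b' z.2)%:E)%E.
  rewrite (plans_integral_snd ppi mb' b'0) integral_mkcond.
  by apply: eq_integral => y _; rewrite restrict_EFin.
rewrite -ge0_integralD//; try by move=> z _; rewrite lee_fin.
rewrite -ge0_integralD//; last 4 first.
- by move=> z _; rewrite lee_fin.
- exact/measurable_EFinP.
- by move=> z _; rewrite adde_ge0// lee_fin.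
- exact: emeasurable_funD.
apply: ge0_le_integral => //.
- by move=> z _; rewrite lee_fin.
- exact/measurable_EFinP.
- by apply: emeasurable_funD; [exact/measurable_EFinP|exact: emeasurable_funD].
move=> [x y] _; rewrite -!EFinD lee_fin /=.
have := hab x y; have := aa' x; have := bb' y; have := a'0 x; have := b'0 y.
by case: (leP (h (x, y)) (r + r)) => ?; lra.
Qed.

End cost_estimates.

Lemma lee_step (R : realType) (x y z : \bar R) (c d : R) :
  (x <= y + c%:E)%E -> (y <= z + d%:E)%E -> (x <= z + (d + c)%:E)%E.
Proof.
by move=> xy yz; apply: (le_trans xy); rewrite EFinD addeA leeD2r.
Qed.

Lemma uniformly_tight_with (R : realType) (Z : ptopologicalType)
    (mu_ : nat -> borel_probability R Z) (mu : borel_probability R Z) (e : R) :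
  hausdorff_space Z -> uniformly_tight (range mu_) -> radon mu -> 0 < e ->
  exists K : set Z, [/\ compact K, (mu (~` K) <= e%:E)%E
    & forall n, (mu_ n (~` K) <= e%:E)%E].
Proof.
move=> hZ tmu rmu e0.
have [K1 [cK1 muK1]] := tmu e e0.
have [K2 [cK2 muK2]] := radon_tight rmu e0.
have cK := compactU cK1 cK2.
have mnC (K : set Z) : compact K -> measurable (~` K : set (borel Z)).
  by move=> ?; apply: measurableC; exact: compact_borel.
exists (K1 `|` K2); split=> // [|n].
  apply: le_trans muK2; apply: le_measure; rewrite ?inE; try exact: mnC.
  by apply: subsetC; exact: subsetUr.
apply: (@le_trans _ _ (mu_ n (~` K1))); last by apply/ltW/muK1; exists n.
apply: le_measure; rewrite ?inE; try exact: mnC.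
by apply: subsetC; exact: subsetUl.
Qed.

Section convergence.
Context {R : realType} {X Y : ptopologicalType}.
Hypotheses (bX : has_bumps R X) (bY : has_bumps R Y).
Hypotheses (hX : hausdorff_space X) (hY : hausdorff_space Y).
Variables (mu_ : nat -> borel_probability R X) (mu : borel_probability R X).
Variables (nu_ : nat -> borel_probability R Y) (nu : borel_probability R Y).
Hypotheses (radon_mu_ : forall n, radon (mu_ n)) (radon_mu : radon mu).
Hypotheses (radon_nu_ : forall n, radon (nu_ n)) (radon_nu : radon nu).
Hypotheses (cvg_mu : weakly_converges mu_ mu) (cvg_nu : weakly_converges nu_ nu).
Hypotheses (tight_mu : uniformly_tight (range mu_)).
Hypotheses (tight_nu : uniformly_tight (range nu_)).
Variables (h_ : nat -> X * Y -> R) (h : X * Y -> R).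
Hypotheses (h_ge0_ : forall n z, 0 <= h_ n z) (h_ge0 : forall z, 0 <= h z).
Hypotheses (h_cont : forall n, continuous (h_ n)).
Hypothesis cvg_h : {family compact, h_ @ \oo --> h}.
Variables (a : nat -> borel X -> R) (b : nat -> borel Y -> R).
Hypotheses (a_ge0 : forall n x, 0 <= a n x) (b_ge0 : forall n y, 0 <= b n y).
Hypotheses (a_borel : forall n, measurable_fun setT (a n)).
Hypotheses (b_borel : forall n, measurable_fun setT (b n)).
Hypothesis h_le : forall n (x : X) (y : Y), h_ n (x, y) <= a n x + b n y.
Hypothesis unif_int :
  ereal_sup (range (fun n : nat =>
    (\int[mu_ n]_(x in [set x | (r <= a n x)%R]) (a n x)%:E +
     \int[nu_ n]_(y in [set y | (r <= b n y)%R]) (b n y)%:E)%E))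
  @[r --> (+oo : set_system R)] --> (0 : \bar R)%E.

Lemma uniform_tails (e : R) : 0 < e ->
  \forall r \near (+oo : set_system R), forall n,
    (\int[mu_ n]_(x in [set x | (r <= a n x)%R]) (a n x)%:E +
     \int[nu_ n]_(y in [set y | (r <= b n y)%R]) (b n y)%:E <= e%:E)%E.
Proof.
move=> e0; pose g (r : R) : \bar R := ereal_sup (range (fun n : nat =>
  (\int[mu_ n]_(x in [set x | (r <= a n x)%R]) (a n x)%:E +
   \int[nu_ n]_(y in [set y | (r <= b n y)%R]) (b n y)%:E)%E)).
have e_nbhs : nbhs (0 : \bar R)%E [set x | (x < e%:E)%E].
  by apply: open_nbhs_nbhs; split; [exact: open_ereal_lt_ereal|rewrite /= lte_fin].
have : \forall r \near (+oo : set_system R), (g r < e%:E)%E.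
  exact: (unif_int e_nbhs).
apply: filterS => r ge_r n; apply: le_trans (ltW ge_r).
by apply: ereal_sup_ubound; exists n.
Qed.

Import HBNNSimple.

(** The costs are chained through one fixed [F]: under [sigma'], [sigma_ n], the competitor [pi] and
    [sigma] in turn, with optimality used for [h_ n] between [sigma_ n] and [pi]. The tail condition
    is needed only under [pi], where an upper bound for the untruncated [h_ n] is sought; elsewhere
    truncation goes in the favourable direction. *)
Lemma limit_plan_cost (U : set_system nat) (PU : ProperFilter U)
    (sigma_ : nat -> borel_probability R (X * Y)%type)
    (sigma' sigma : borel_probability R (X * Y)%type) :
  (\oo `<=` U) -> (forall n, optimal_plan (mu_ n) (nu_ n) (h_ n) (sigma_ n)) ->
  plans mu nu sigma' -> plans mu nu sigma ->
  (forall f, bcont f -> mean (sigma_ n) f @[n --> U] --> mean sigma' f) ->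
  (\int[sigma']_z (h z)%:E <= \int[sigma]_z (h z)%:E)%E.
Proof.
move=> ooU opt_ psigma' psigma cvg_sigma.
(* A simple function [s] below [h] is measurable and bounded, so the truncation level can be taken
   above it, even if the cost of [sigma'] is not yet known to be finite. *)
rewrite [leLHS]ge0_integralTE; last by move=> z; rewrite lee_fin.
apply: ge_ereal_sup => _ [s /= sh <-]; rewrite -integralT_nnsfun.
(* Since [M * (2 * d) <= 2 * e], steps 1 and 8 cost [3 * e] each, steps 3 and 6 cost [4 * e] each,
   and steps 2, 5 and 7 cost [e] each: 17 in all. *)
apply/lee_addgt0Pr => e' e'0; pose e := e' / 17.
have e0 : 0 < e by rewrite divr_gt0.
have [S sS] : exists S, forall z, s z <= S.
  have [S [_ Ss]] := simple_bounded s; exists (S + 1) => z.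
  by apply: le_trans (ler_norm _) _; apply: Ss => //; rewrite ltrDl.
have [r [tails Sr r0]] : exists r, [/\ forall n,
    (\int[mu_ n]_(x in [set x | (r <= a n x)%R]) (a n x)%:E +
     \int[nu_ n]_(y in [set y | (r <= b n y)%R]) (b n y)%:E <= e%:E)%E,
    S <= r & 0 <= r].
  have [r [? [? ?]]] := filter_ex (filterI (uniform_tails e0) (filterI
    (nbhs_pinfty_ge (num_real S)) (nbhs_pinfty_ge (num_real (0 : R))))).
  by exists r.
pose M := r + r; have M0 : 0 <= M by rewrite addr_ge0.
have SM z : s z <= M by rewrite (le_trans (sS z))// (le_trans Sr)// lerDr.
have M1 : 0 < M + 1 by rewrite ltr_wpDl.
pose d := e / (M + 1); have d0 : 0 < d by rewrite divr_gt0.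
have Md : M * (2 * d) <= 2 * e.
  rewrite mulrCA ler_wpM2l// /d mulrA ler_pdivrMr// mulrC ler_wpM2l ?ltW//.
  by rewrite ltrDl.
have [K [cK muK mu_K]] := uniformly_tight_with hX tight_mu radon_mu d0.
have [L [cL nuL nu_L]] := uniformly_tight_with hY tight_nu radon_nu d0.
have cKL : compact (K `*` L) by exact: compact_setX.
have mKL : measurable (K `*` L : set (borel (X * Y)%type)).
  by apply: compact_borel => //; exact: hausdorff_prod.
have near_h : \forall n \near \oo, forall z, (K `*` L) z -> `|h z - h_ n z| <= e.
  exact: family_cvg_near.
(* [N] is fixed before [n], so that [F] is one test function for the whole sequence. On the
   rectangle [h_ N] and [h_ n] are then [2 * e] apart, through [h]. *)
have [N _ hN] := near_h.
pose F z := Num.min (h_ N z) M.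
have cF : bcont F by exact: bcont_min_cst.
have F0 z : 0 <= F z by rewrite le_min h_ge0_.
have FM z : F z <= M by rewrite ge_min lexx orbT.
have mF := continuous_measurable_real cF.1.
have near_sigma : \forall n \near U, mean sigma' F <= mean (sigma_ n) F + e.
  have := cvg_sigma F cF => /cvgrPdist_le /(_ e e0).
  by apply: filterS => n; rewrite ler_norml; lra.
have near_pi : \forall n \near \oo, exists pi, plans (mu_ n) (nu_ n) pi /\
    mean pi F <= mean sigma F + e.
  exact: (approximating_plans bX bY hX hY radon_mu_ radon_mu radon_nu_ radon_nu).
have [n [[hn [pi [ppi piF]]] sigma_n]] :=
  filter_ex (filterI (ooU _ (filterI near_h near_pi)) near_sigma).
have [psigma_n opt_n] := opt_ n.
have tail_n (P : borel_probability R (X * Y)%type) :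
    plans (mu_ n) (nu_ n) P -> (P (~` (K `*` L)) <= (2 * d)%:E)%E.
  by move=> pP; apply: plans_setC_prod pP _ _ _ _.
have tail_0 (P : borel_probability R (X * Y)%type) :
    plans mu nu P -> (P (~` (K `*` L)) <= (2 * d)%:E)%E.
  by move=> pP; apply: plans_setC_prod pP _ _ _ _.
have hNe z : (K `*` L) z -> `|h z - h_ N z| <= e by apply: (hN N); rewrite /= leqnn.
have meanF (P : borel_probability R (X * Y)%type) :
    (\int[P]_(z in [set: borel (X * Y)%type]) (F z)%:E = (mean P F)%:E)%E.
  by rewrite meanE.
have step1 : (\int[sigma']_(z in [set: borel (X * Y)%type]) (s z)%:E <=
    \int[sigma']_(z in [set: borel (X * Y)%type]) (F z)%:E +
    (e + M * (2 * d))%:E)%E.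
  apply: (integral_compare (K := K `*` L)) => //.
  - by move=> z; rewrite SM andbT.
  - move=> z /hNe; have := sh z; rewrite lee_fin ler_norml /F => sz hz.
    by have := SM z; case: (leP (h_ N z) M); lra.
  - exact: ltW.
  - exact: tail_0.
have step2 : ((mean sigma' F)%:E <= (mean (sigma_ n) F)%:E + e%:E)%E.
  by rewrite -EFinD lee_fin.
have step3 : (\int[sigma_ n]_(z in [set: borel (X * Y)%type]) (F z)%:E <=
    \int[sigma_ n]_(z in [set: borel (X * Y)%type]) (h_ n z)%:E +
    (2 * e + M * (2 * d))%:E)%E.
  apply: (integral_compare (K := K `*` L)) => //.
  - by move=> z; rewrite F0 FM.
  - move=> z Kz; have := hNe z Kz; have := hn z Kz; rewrite !ler_norml /F => h1 h2.
    by rewrite ge_min; apply/orP; left; lra.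
  - by rewrite mulr_ge0// ltW.
  - exact: tail_n.
have step4 : (\int[sigma_ n]_(z in [set: borel (X * Y)%type]) (h_ n z)%:E <=
    \int[pi]_(z in [set: borel (X * Y)%type]) (h_ n z)%:E)%E.
  by rewrite opt_n; apply: ereal_inf_lbound; exists pi.
have step5 : (\int[pi]_(z in [set: borel (X * Y)%type]) (h_ n z)%:E <=
    \int[pi]_(z in [set: borel (X * Y)%type]) (Num.min (h_ n z) M)%:E + e%:E)%E.
  apply: le_trans (cost_truncation ppi (@h_cont n) (h_ge0_ n) (a_ge0 n) (b_ge0 n)
    (@a_borel n) (@b_borel n) (@h_le n) r0) _.
  by rewrite leeD2l.
have step6 : (\int[pi]_(z in [set: borel (X * Y)%type]) (Num.min (h_ n z) M)%:E <=
    \int[pi]_(z in [set: borel (X * Y)%type]) (F z)%:E +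
    (2 * e + M * (2 * d))%:E)%E.
  have cmin : bcont (fun z => Num.min (h_ n z) M) by exact: bcont_min_cst.
  apply: (integral_compare (K := K `*` L)) => //.
  - exact: continuous_measurable_real cmin.1.
  - by move=> z; rewrite le_min h_ge0_ M0 ge_min lexx orbT.
  - move=> z Kz; have := hNe z Kz; have := hn z Kz; rewrite !ler_norml /F => h1 h2.
    by case: (leP (h_ N z) M) => ?; rewrite ge_min; apply/orP; [left|right]; lra.
  - by rewrite mulr_ge0// ltW.
  - exact: tail_n.
have step7 : ((mean pi F)%:E <= (mean sigma F)%:E + e%:E)%E.
  by rewrite -EFinD lee_fin.
have step8 : (\int[sigma]_(z in [set: borel (X * Y)%type]) (F z)%:E <=
    \int[sigma]_(z in [set: borel (X * Y)%type]) (h z)%:E +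
    (e + M * (2 * d))%:E)%E.
  apply: (integral_compare (K := K `*` L)) => //.
  - by move=> z; rewrite F0 FM.
  - move=> z /hNe; rewrite ler_norml /F => hz.
    by rewrite ge_min; apply/orP; left; lra.
  - exact: ltW.
  - exact: tail_0.
rewrite meanF in step1; rewrite meanF in step3; rewrite meanF in step6.
rewrite meanF in step8.
have := lee_step (lee_step (lee_step (lee_step (lee_step (lee_step step1 step2)
  (le_trans step3 (leeD2r _ step4))) step5) step6) step7) step8.
move/le_trans; apply; rewrite leeD2l// lee_fin.
have -> : e' = 17 * e by rewrite /e; field.
move: Md; lra.
Qed.

End convergence.

Unset Implicit Arguments.

Theorem corollary3p5 (R : realType) (X Y : ptopologicalType)
  (crX : completely_regular_hausdorff X) (crY : completely_regular_hausdorff Y)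
  (mu_ : nat -> borel_probability R X) (mu : borel_probability R X)
  (nu_ : nat -> borel_probability R Y) (nu : borel_probability R Y)
  (radon_mu_ : forall n, radon (mu_ n)) (radon_mu : radon mu)
  (radon_nu_ : forall n, radon (nu_ n)) (radon_nu : radon nu)
  (cvg_mu : weakly_converges mu_ mu) (cvg_nu : weakly_converges nu_ nu)
  (tight_mu : uniformly_tight (range mu_))
  (tight_nu : uniformly_tight (range nu_))
  (h_ : nat -> X * Y -> R) (h : X * Y -> R)
  (h_ge0_ : forall n z, 0 <= h_ n z) (h_ge0 : forall z, 0 <= h z)
  (h_cont : forall n, continuous (h_ n))
  (cvg_h : {family compact, h_ @ \oo --> h})
  (a : nat -> borel X -> R) (b : nat -> borel Y -> R)
  (a_ge0 : forall n x, 0 <= a n x) (b_ge0 : forall n y, 0 <= b n y)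
  (a_borel : forall n, measurable_fun setT (a n))
  (b_borel : forall n, measurable_fun setT (b n))
  (a_L1 : forall n, (mu_ n).-integrable setT (EFin \o a n))
  (b_L1 : forall n, (nu_ n).-integrable setT (EFin \o b n))
  (h_le : forall n (x : X) (y : Y), h_ n (x, y) <= a n x + b n y)
  (unif_int :
    ereal_sup (range (fun n : nat =>
      (\int[mu_ n]_(x in [set x | (r <= a n x)%R]) (a n x)%:E +
       \int[nu_ n]_(y in [set y | (r <= b n y)%R]) (b n y)%:E)%E))
    @[r --> (+oo : set_system R)] --> (0 : \bar R)%E)
  (sigma_ : nat -> borel_probability R (X * Y)%type)
  (sigma : borel_probability R (X * Y)%type)
  (opt_ : forall n, unique_optimal_plan (mu_ n) (nu_ n) (h_ n) (sigma_ n))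
  (opt : unique_optimal_plan mu nu h sigma) :
  weakly_converges sigma_ sigma.
Proof.
move=> f f_cont f_bnd.
have bX := @completely_regular_has_bumps R _ crX.1.
have bY := @completely_regular_has_bumps R _ crY.1.
have hX := crX.2; have hY := crY.2.
have cf : bcont f by exact/bcont_bounded_fun.
have fE (P : borel_probability R (X * Y)%type) :
    (\int[P]_(z in [set: borel (X * Y)%type]) (f z)%:E)%E = (mean P f)%:E.
  by rewrite meanE.
rewrite fE; under eq_fun do rewrite fE.
apply/fine_cvgP; split; first exact: nearW.
apply/cvgrPdist_lt => e e0; apply: contrapT => far.
(* If convergence fails, [D] meets every eventual set. An ultrafilter containing [D] and all
   eventual sets then acts as a subsequence staying at distance at least [e]. *)
pose D := [set n | ~ (`|mean sigma f - mean (sigma_ n) f| < e)].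
have PD : ProperFilter (within D \oo).
  split; last exact: within_filter.
  by rewrite /within/= => D0; apply: far; apply: filterS D0 => n Dn; exact: contrapT.
have [U [UU DU]] := ultraFilterLemma PD.
have PU : ProperFilter U by exact: ultra_proper.
have ooU : \oo `<=` U.
  by move=> A ooA; apply: DU; rewrite /within/=; apply: filterS ooA => n An _.
have opt_n n : optimal_plan (mu_ n) (nu_ n) (h_ n) (sigma_ n) by have [] := opt_ n.
have psigma_ n : plans (mu_ n) (nu_ n) (sigma_ n) by have [] := opt_n n.
have [[psigma sigma_opt] sigma_uniq] := opt.
have [|sigma' [rsigma' cvg_sigma]] := @ultra_prokhorov R (X * Y)%type nat sigma_ U
  (has_bumps_prod bX bY) (hausdorff_prod hX hY) UU.
  move=> d d0; have d20 : 0 < d / 2 by rewrite divr_gt0.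
  have [K [cK _ mu_K]] := uniformly_tight_with hX tight_mu radon_mu d20.
  have [L [cL _ nu_L]] := uniformly_tight_with hY tight_nu radon_nu d20.
  exists (K `*` L); split=> [|n]; first exact: compact_setX.
  have -> : d = 2 * (d / 2) by rewrite mulrC divfK.
  exact: (plans_setC_prod hX hY (psigma_ n)).
(* The marginal means converge along [U] both to those of [sigma'] and, as [U] refines [\oo], to
   those of [mu] and [nu]; limits in [R] are unique. *)
have psigma' : plans mu nu sigma'.
  apply: plans_mean => // [phi cphi|psi cpsi].
    have cphi1 := bcont_comp (@fst_continuous X Y) cphi.
    apply: (cvg_unique (@Rhausdorff R) (cvg_sigma _ cphi1)).
    have := weakly_converges_mean cvg_mu cphi => /(cvg_trans (cvg_fmap2 ooU)).
    by under eq_fun do rewrite -(plans_mean_fst (psigma_ _) cphi).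
  have cpsi2 := bcont_comp (@snd_continuous X Y) cpsi.
  apply: (cvg_unique (@Rhausdorff R) (cvg_sigma _ cpsi2)).
  have := weakly_converges_mean cvg_nu cpsi => /(cvg_trans (cvg_fmap2 ooU)).
  by under eq_fun do rewrite -(plans_mean_snd (psigma_ _) cpsi).
have cost_le : (\int[sigma']_z (h z)%:E <= \int[sigma]_z (h z)%:E)%E.
  exact: (limit_plan_cost bX bY hX hY radon_mu_ radon_mu radon_nu_ radon_nu
    cvg_mu cvg_nu tight_mu tight_nu h_ge0_ h_ge0 h_cont cvg_h a_ge0 b_ge0
    a_borel b_borel h_le unif_int PU ooU opt_n psigma' psigma cvg_sigma).
have opt' : optimal_plan mu nu h sigma'.
  split=> //; apply/eqP; rewrite eq_le -{1}sigma_opt cost_le/=.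
  by apply: ereal_inf_lbound; exists sigma'.
(* Uniqueness identifies the two plans on Borel sets, which is all that the integral of [f] sees. *)
have sigma'f : mean sigma' f = mean sigma f.
  apply: EFin_inj; rewrite -!fE; apply: eq_measure_integral => C mC _.
  exact: sigma_uniq.
have := cvg_sigma f cf; rewrite sigma'f => /cvgrPdist_lt /(_ e e0) close.
have UD : U D by apply: DU; exact: withinT.
by have [n [Dn ?]] := filter_ex (filterI UD close); apply: Dn.
Qed.
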